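(* Let $n\ge 2$, let $a_1,\dots,a_n,c_1,\dots,c_n$ be strictly positive real constants, and consider the cyclic linear dynamical network $$\dot x_1=-a_1x_1-c_nx_n+\xi_1,\qquad \dot x_i=-a_ix_i+c_{i-1}x_{i-1}+\xi_i\quad(i=2,\dots,n),$$ with output $y=x$, driven by a zero-mean white stochastic process $\xi=(\xi_1,\dots,\xi_n)^{\mathrm T}$ with covariance $\mathbf{E}[\xi(t)\xi(\tau)^{\mathrm T}]=I_{n\times n}\delta(t-\tau)$. Let $A\in\mathbb{R}^{n\times n}$ be its state matrix. Define $\mathfrak a=\sqrt[n]{a_1a_2\cdots a_n}$, $\mathfrak c=\sqrt[n]{c_1c_2\cdots c_n}$ and $\gamma=\mathfrak a/\mathfrak c$. If $\gamma>\cos(\pi/n)$, then the network is stable (i.e. $A$ is Hurwitz). Moreover, if (in addition to $\gamma>\cos(\pi/n)$) $\mathfrak a=a_1=\cdots=a_n$, then $$\rho_{ss}(A;I_{n\times n})\;\ge\;-\sum_{i=1}^n\frac{1}{2\,\mathrm{Re}\{\lambda_i(A)\}}\;=\;\begin{cases}\dfrac{n\tan\frac{\beta}{2}}{2\mathfrak c\,\sin\frac{\beta}{n}}, & \gamma<1,\\[2ex] \dfrac{n^2}{4\mathfrak c}, & \gamma=1,\\[2ex] \dfrac{n\tanh\frac{\beta}{2}}{2\mathfrak c\,\sinh\frac{\beta}{n}}, & \gamma>1,\end{cases}$$ where $\beta=n\arccos(\gamma)$ if $\gamma\le 1$ and $\beta=n\,\mathrm{arcosh}(\gamma)$ if $\gamma>1$.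 Equality in the inequality is achieved if and only if $c_1=\cdots=c_n$.
   Context: The state matrix $A$ of the network has $A_{ii}=-a_i$ for $i=1,\dots,n$, $A_{i,i-1}=c_{i-1}$ for $i=2,\dots,n$, $A_{1n}=-c_n$, and all other entries zero. A matrix is Hurwitz if all its eigenvalues have strictly negative real parts. $\lambda_1(A),\dots,\lambda_n(A)$ are the complex eigenvalues of $A$ counted with multiplicity. For the system $\dot x=Ax+\xi$, $x(0)=0$, with $A$ Hurwitz and $\xi$ zero-mean white noise with identity covariance, and for $Q$ symmetric positive semidefinite, $\rho_{ss}(A;Q)=\lim_{t\to\infty}\mathbf{E}[x^{\mathrm T}(t)Qx(t)]$ (the squared $\mathcal{H}_2$-norm from $\xi$ to an output $y=Cx$ with $Q=C^{\mathrm T}C$). It equals $\mathrm{Tr}(P)$, where $P$ is the unique solution of $PA+A^{\mathrm T}P+Q=0$. *)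

(* Defs.v *)
From HB Require Import structures.
From mathcomp Require Import all_boot all_order all_algebra.
From mathcomp Require Import complex.
From mathcomp Require Import all_classical all_reals all_analysis.
Set Implicit Arguments.
Unset Strict Implicit.
Unset Printing Implicit Defensive.
Import Order.TTheory GRing.Theory Num.Theory.
Import numFieldNormedType.Exports.
Local Open Scope classical_set_scope.
Local Open Scope ring_scope.

(* Indices run over 0, ..., n-1, so a i and c i below are a_{i+1} and c_{i+1}.
   The three nonzero positions are disjoint as soon as 1 < n. *)
Definition cyclic_mx (R : realType) (n : nat) (a c : 'I_n -> R) : 'M[R]_n :=
  \matrix_(i < n, j < n)
    if i == j then - a i
    else if (i == j.+1 :> nat)%N then c j
    else if (i == 0 :> nat)%N && (j == n.-1 :> nat)%N then - c j
    else 0.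

Definition complex_mx (R : realType) (n : nat) (A : 'M[R]_n) : 'M[complex R]_n :=
  map_mx (real_complex R) A.

Definition hurwitz (R : realType) (n : nat) (A : 'M[R]_n) : Prop :=
  forall l : complex R, eigenvalue (complex_mx A) l -> complex.Re l < 0.

(* Eigenvalues with algebraic multiplicity: the n roots of the (monic)
   characteristic polynomial, in some order. *)
Definition eigenvalues (R : realType) (n : nat) (A : 'M[R]_n) : seq (complex R) :=
  sval (closed_field_poly_normal (char_poly (complex_mx A))).

(* The white noise xi with E[xi(t) xi(s)^T] = I delta(t - s) is a generalized
   process; it is represented by its primitive W(t) = int_0^t xi, for which the
   condition reads E[W(s) W(t)^T] = min(s, t) I.  No Gaussianity and no path
   continuity is required. *)
Record white_noise_primitive (R : realType) (d : measure_display)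
    (T : measurableType d) (P : probability T R) (n : nat)
    (W : 'I_n -> R -> T -> R) : Prop := WhiteNoisePrimitive {
  wn_measurable : forall i : 'I_n,
    measurable_fun ([set t : R | 0 <= t] `*` [set: T])
      (fun p : R * T => W i p.1 p.2) ;
  wn_mean : forall (i : 'I_n) (t : R), 0 <= t -> ('E_P[W i t] = 0%:E)%E ;
  wn_cov : forall (i j : 'I_n) (s t : R), 0 <= s -> 0 <= t ->
    ('E_P[(fun w => W i s w * W j t w)%R] =
      (if i == j then Num.min s t else 0)%R%:E)%E
}.

(* Mean-square solution of dx/dt = A x + dW/dt, x(0) = 0.  Since the noise is
   additive, this is the integral equation x(t) = int_0^t A x(s) ds + W(t),
   with an ordinary (pathwise) Lebesgue integral, holding almost surely for
   each t. *)
Record driven_state (R : realType) (d : measure_display)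
    (T : measurableType d) (P : probability T R) (n : nat) (A : 'M[R]_n)
    (W x : 'I_n -> R -> T -> R) : Prop := DrivenState {
  st_measurable : forall i : 'I_n,
    measurable_fun ([set t : R | 0 <= t] `*` [set: T])
      (fun p : R * T => x i p.1 p.2) ;
  st_square : forall (i : 'I_n) (t : R), 0 <= t ->
    (\int[lebesgue_measure]_(s in `[0%R, t]) 'E_P[(fun w => x i s w ^+ 2)%R]
       < +oo)%E ;
  st_init : forall i : 'I_n, {ae P, forall w, x i 0 w = 0} ;
  st_equation : forall (i : 'I_n) (t : R), 0 <= t ->
    {ae P, forall w,
      x i t w =
        \int[lebesgue_measure]_(s in `[0, t]) (\sum_(j < n) A i j * x j s w)
        + W i t w}
}.

Definition output_power (R : realType) (d : measure_display)
    (T : measurableType d) (P : probability T R) (n : nat) (Q : 'M[R]_n)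
    (x : 'I_n -> R -> T -> R) (t : R) : \bar R :=
  ('E_P[(fun w => \sum_(i < n) \sum_(j < n) x i t w * Q i j * x j t w)%R])%E.

(* "rho_ss(A; Q) = rho": along the state of the noise-driven system,
   E[x(t)^T Q x(t)] converges to rho, whatever the probability space and the
   white noise. *)
Definition is_rho_ss (R : realType) (n : nat) (A Q : 'M[R]_n) (rho : R) : Prop :=
  forall (d : measure_display) (T : measurableType d) (P : probability T R)
    (W x : 'I_n -> R -> T -> R),
    white_noise_primitive P W -> driven_state P A W x ->
    output_power P Q x t @[t --> +oo] --> rho%:E.

Definition geometric_mean (R : realType) (n : nat) (u : 'I_n -> R) : R :=
  (\prod_(i < n) u i) `^ (n%:R^-1).

Definition sinh (R : realType) (x : R) : R := (expR x - expR (- x)) / 2.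
Definition cosh (R : realType) (x : R) : R := (expR x + expR (- x)) / 2.
Definition tanh (R : realType) (x : R) : R := sinh x / cosh x.

(* Inverse of cosh on [0, +oo[, used for 1 <= x. *)
Definition arcosh (R : realType) (x : R) : R :=
  ln (x + Num.sqrt (x ^+ 2 - 1)).

Definition cyclic_beta (R : realType) (n : nat) (gamma : R) : R :=
  if gamma <= 1 then n%:R * acos gamma else n%:R * arcosh gamma.

Definition cyclic_bound (R : realType) (n : nat) (cm gamma : R) : R :=
  let beta := cyclic_beta n gamma in
  if gamma < 1 then n%:R * tan (beta / 2) / (2 * cm * sin (beta / n%:R))
  else if gamma == 1 then n%:R ^+ 2 / (4 * cm)
  else n%:R * tanh (beta / 2) / (2 * cm * sinh (beta / n%:R)).

(* Main.v *)
(* Stability.  A diagonal change of variables turns x^T P A x, for a suitable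
   positive diagonal matrix P, into
     -|y|^2 + (1 / gamma) (y_0 y_1 + ... + y_(n-2) y_(n-1) - y_(n-1) y_0),
   and a discrete Wirtinger inequality bounds the bracket by
   cos(pi / n) |y|^2, so that x^T P x is a strict Lyapunov function.

   Steady-state power.  By Fubini, M(s, u) = E[x(s) W(u)^T] and
   K(s, u) = E[x(s) x(u)^T] solve linear Volterra equations in s.  These have
   unique solutions: E(t) = I + A M(t, t) satisfies E' = A E and E(0) = I, and
   K(t, t) = X - E(t) X E(t)^T, where A X + X A^T + I = 0.  Since E decays,
   rho_ss = tr X.

   Inequality.  With equal rates, A = D B D^-1, where D is diagonal and
   B + a I is a multiple of an orthogonal matrix, hence B is normal.  Let
   G_ij >= 0 be the i-th diagonal entry of the solution Y of
   B Y + Y B^T + e_j e_j^T = 0.  Then tr X = sum_ij (d_i / d_j)^2 G_ij; the row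
   and column sums of G agree, so e^t >= 1 + t gives
   tr X >= sum_ij G_ij = tr (- (B + B^T))^-1 = - sum_l 1 / (2 Re l), with
   equality only if D is scalar because G_(i+1),i > 0.

   Closed form.  The eigenvalues are l = mu - a with mu^n = - c^n, and
   2 Re l = (mu - v) (mu - w) / mu when v + w = 2 a and v w = c^2, so the sum is
   read off the logarithmic derivative of mu^n + c^n at v and w. *)

Require Import Defs.
From HB Require Import structures.
From mathcomp Require Import all_boot all_order all_algebra.
From mathcomp Require Import complex.
From mathcomp Require Import all_classical all_reals all_analysis.
From mathcomp Require Import measurable_realfun.
From mathcomp Require Import separable spectral.
From mathcomp Require Import ring lra.
Set Implicit Arguments.
Unset Strict Implicit.
Unset Printing Implicit Defensive.
Import Order.TTheory GRing.Theory Num.Theory.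
Import numFieldNormedType.Exports.
Local Open Scope classical_set_scope.
Local Open Scope ring_scope.

(** * Second moments of the noise-driven state *)

(** The assumptions on the noise concern second moments only, and the state equation holds almost
    surely at each fixed time. So no stochastic calculus is used: the equation is multiplied by a
    square-integrable variable and averaged, and everything afterwards is deterministic. The moments
    are a priori merely integrable in time; the integral equation first makes them continuous, then
    differentiable.

    One energy estimate with diagonal weights has three uses: it places the spectrum in the left
    half-plane, it gives uniqueness for all the linear equations, and it makes E decay. The matrix
    exponential is never constructed: E is read off the correlation of state and noise, and its
    algebraic properties follow from uniqueness.

    The row and column sums of G agree because, for normal B, the matrix (- (B + B^T))^-1 solves
    both the Lyapunov equation of B and that of B^T. The spectral sums of A and B are identified
    through the closed form, which sees the couplings only through their geometric mean. *)

Section fubini_on.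
Context d1 d2 (T1 : measurableType d1) (T2 : measurableType d2) (R : realType).
Variables (m1 : {sigma_finite_measure set T1 -> \bar R})
  (m2 : {sigma_finite_measure set T2 -> \bar R}).
Variables (D : set T1) (f : T1 -> T2 -> R).
Hypotheses (mD : measurable D)
  (mf : measurable_fun (D `*` [set: T2]) (fun p : T1 * T2 => f p.1 p.2)).

(** Extension by zero outside the slab: the processes are measurable only for nonnegative times,
    while Fubini and Tonelli are applied on the whole product. *)
Let g : T1 * T2 -> \bar R :=
  (fun p => (f p.1 p.2)%:E) \_ (D `*` [set: T2]).

Let mg : measurable_fun setT g.
Proof.
apply/(measurable_restrictT _ _).1; first exact: measurableX.
exact/measurable_EFinP.
Qed.

Let gE1 s : (fun w => g (s, w)) = if s \in D then (fun w => (f s w)%:E) else cst 0%E.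
Proof.
apply/funext => w; rewrite /g patchE.
have -> : ((s, w) \in D `*` [set: T2]) = (s \in D).
  by apply/idP/idP => /set_mem => [[]/= /mem_set//|sD]; apply/mem_set; split.
by case: ifP.
Qed.

Let gE2 w : (fun s => g (s, w)) = (fun s => (f s w)%:E) \_ D.
Proof.
by apply/funext => s; rewrite -[LHS]/((fun w => g (s, w)) w) gE1 patchE; case: ifP.
Qed.

Section nonnegative.
Hypothesis f0 : forall s w, D s -> 0 <= f s w.

Let g0 p : (0 <= g p)%E.
Proof.
case: p => s w; rewrite -[g _]/((fun w => g (s, w)) w) gE1; case: ifP => // /set_mem sD.
by rewrite lee_fin f0.
Qed.

Lemma tonelli_on1 :
  (\int[m1 \x m2]_(p in D `*` [set: T2]) (f p.1 p.2)%:E =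
   \int[m1]_(s in D) \int[m2]_w (f s w)%:E)%E.
Proof.
rewrite integral_mkcond [in LHS](fubini_tonelli1 _ mg g0) [RHS]integral_mkcond.
apply: eq_integral => s _; rewrite /fubini_F gE1 patchE.
by case: ifP => // _; rewrite integral0.
Qed.

Lemma tonelli_on2 :
  (\int[m1 \x m2]_(p in D `*` [set: T2]) (f p.1 p.2)%:E =
   \int[m2]_w \int[m1]_(s in D) (f s w)%:E)%E.
Proof.
rewrite integral_mkcond [in LHS](fubini_tonelli2 _ mg g0).
by apply: eq_integral => w _; rewrite /fubini_G gE2 -integral_mkcond.
Qed.

Lemma measurable_tonelli_on2 :
  measurable_fun setT (fun w => \int[m1]_(s in D) (f s w)%:E)%E.
Proof.
rewrite (_ : (fun w => _) = fubini_G m1 g).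
  exact: measurable_fun_fubini_tonelli_G.
by apply/funext => w; rewrite /fubini_G gE2 -integral_mkcond.
Qed.

End nonnegative.

Hypothesis fi :
  (m1 \x m2)%E.-integrable (D `*` [set: T2]) (fun p => (f p.1 p.2)%:E).

Let gi : (m1 \x m2)%E.-integrable setT g.
Proof. by apply/(integrable_mkcond _ _).1 => //; exact: measurableX. Qed.

Lemma integrable_fubini_on1 :
  m1.-integrable D (fun s => \int[m2]_w (f s w)%:E)%E.
Proof.
apply/integrable_mkcond => //.
apply: eq_integrable (integrable_fubini_F gi) => // s _.
by rewrite /fubini_F gE1 patchE; case: ifP => // _; rewrite integral0.
Qed.

Lemma measurable_fubini_on2 :
  measurable_fun setT (fun w => \int[m1]_(s in D) (f s w)%:E)%E.
Proof.
rewrite (_ : (fun w => _) = fubini_G m1 g); first exact: measurable_fubini_G gi.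
by apply/funext => w; rewrite /fubini_G gE2 -integral_mkcond.
Qed.

Lemma ae_integrable_fubini_on2 :
  {ae m2, forall w, m1.-integrable D (fun s => (f s w)%:E)}.
Proof.
apply: filterS (ae_integrable2 gi) => w; rewrite gE2.
by move=> ?; exact/integrable_mkcond.
Qed.

Lemma fubini_on :
  (\int[m1]_(s in D) \int[m2]_w (f s w)%:E =
   \int[m2]_w \int[m1]_(s in D) (f s w)%:E)%E.
Proof.
rewrite integral_mkcond.
under [RHS]eq_integral do rewrite integral_mkcond -gE2.
rewrite -Fubini//.
by apply: eq_integral => s _; rewrite gE1 patchE; case: ifP => // _; rewrite integral0.
Qed.

End fubini_on.

(** * Square-integrable functions on a measurable set *)

Section square_integrable.
Context d (T : measurableType d) (R : realType) (P : {measure set T -> \bar R}).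
Variables (D : set T) (mD : measurable D).
Implicit Types X Y : T -> R.

Definition square_integrable X :=
  measurable_fun D X /\ (\int[P]_(w in D) (X w ^+ 2)%:E < +oo)%E.

Lemma integrable_square_integrable X : square_integrable X ->
  P.-integrable D (fun w => (X w ^+ 2)%:E).
Proof.
move=> [mX iX]; apply/integrableP; split.
  by apply/measurable_EFinP; exact: measurable_funX.
by under eq_integral do rewrite gee0_abs ?lee_fin ?sqr_ge0//.
Qed.

Lemma square_integrableM X Y : square_integrable X -> square_integrable Y ->
  P.-integrable D (EFin \o (fun w => X w * Y w)).
Proof.
move=> lX lY; have [[mX _] [mY _]] := (lX, lY).
apply: le_integrable (integrableD _ (integrable_square_integrable lX)
  (integrable_square_integrable lY)) => //.
  by apply/measurable_EFinP; exact: measurable_funM.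
move=> w _ /=; rewrite lee_fin normrM [leRHS]ger0_norm ?addr_ge0 ?sqr_ge0//.
rewrite -(real_normK (num_real (X w))) -(real_normK (num_real (Y w))).
have := sqr_ge0 (`|X w| - `|Y w|); have := normr_ge0 (X w); have := normr_ge0 (Y w).
by set u := `|X w|; set v := `|Y w|; nra.
Qed.

Lemma square_integrableD X Y : square_integrable X -> square_integrable Y ->
  square_integrable (fun w => X w + Y w).
Proof.
move=> lX lY; have [[mX _] [mY _]] := (lX, lY); split; first exact: measurable_funD.
have iXY : P.-integrable D
    (fun w => ((2%:E * (X w ^+ 2)%:E) + (2%:E * (Y w ^+ 2)%:E))%E).
  by apply: integrableD => //; apply: integrableZl => //;
    exact: integrable_square_integrable.
apply: le_lt_trans (integrable_lty _ iXY) => //.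
apply: ge0_le_integral => //.
- by move=> w _; rewrite lee_fin sqr_ge0.
- by apply/measurable_EFinP; apply: measurable_funX; exact: measurable_funD.
- exact: measurable_int iXY.
- move=> w _; rewrite -!EFinM -EFinD lee_fin.
  by have := sqr_ge0 (X w - Y w); nra.
Qed.

Lemma square_integrableZ k X : square_integrable X ->
  square_integrable (fun w => k * X w).
Proof.
move=> lX; have [mX _] := lX; split; first exact: measurable_funM.
under eq_integral do rewrite exprMn EFinM.
rewrite integrable_lty//; apply: integrableZl => //.
exact: integrable_square_integrable.
Qed.

Lemma square_integrable_sum n (F : 'I_n -> T -> R) :
  (forall k, square_integrable (F k)) ->
  square_integrable (fun w => \sum_(k < n) F k w).
Proof.
move=> lF; elim: (index_enum _) => [|k r ih].
  under eq_fun do rewrite big_nil; split; first exact: measurable_cst.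
  by under eq_integral do rewrite expr0n/=; rewrite integral0.
by under eq_fun do rewrite big_cons; exact: square_integrableD.
Qed.

End square_integrable.

(** Integrate [(m - g s) ^+ 2 >= 0] over the interval and take for [m] the mean [z / t] of [g]. *)
Lemma sqr_Rintegral_le (R : realType) (t : R) (g : R -> R) : 0 <= t ->
  lebesgue_measure.-integrable `[0, t] (EFin \o g) ->
  lebesgue_measure.-integrable `[0, t] (EFin \o (fun s => g s ^+ 2)) ->
  (\int[lebesgue_measure]_(s in `[0, t]) g s) ^+ 2 <=
  t * \int[lebesgue_measure]_(s in `[0, t]) g s ^+ 2.
Proof.
move=> t0 ig ig2; set z := \int[_]_(_ in _) g _; set q := \int[_]_(_ in _) _.
have [t_eq0|tn0] := eqVneq t 0.
  by rewrite /z t_eq0 set_itv1 Rintegral_set1 expr0n mul0r.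
have tp : 0 < t by rewrite lt_neqAle eq_sym tn0.
have ic (k : R) : lebesgue_measure.-integrable `[0, t] (EFin \o cst k).
  apply: measurable_bounded_integrable => //=.
    by rewrite lebesgue_measure_itv /= lte_fin tp ltry.
  by apply: bounded_cst.
have key (m : R) : 2 * m * z <= m ^+ 2 * t + q.
  have -> : m ^+ 2 * t = \int[lebesgue_measure]_(s in `[0, t]) (m ^+ 2).
    by rewrite Rintegral_cst//= lebesgue_measure_itv /= lte_fin tp oppr0 addr0.
  rewrite -RintegralZl// -RintegralD//.
  apply: le_Rintegral => //.
  - by under [X in _.-integrable _ X]eq_fun do rewrite /= EFinM; exact: integrableZl.
  - by rewrite /=; under [X in _.-integrable _ X]eq_fun do rewrite /= EFinD;
      apply: integrableD => //; exact: ic.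
  - by move=> s _; have := sqr_ge0 (m - g s); nra.
  - exact: ic.
have := key (z / t); rewrite -[z ^+ 2 <= _]subr_ge0 -[2 * _ * _ <= _]subr_ge0 => h.
have -> : t * q - z ^+ 2 = t * ((z / t) ^+ 2 * t + q - 2 * (z / t) * z).
  by field.
exact: mulr_ge0.
Qed.

(** * Moment equations of the state *)

Section second_moments.
Context (R : realType) d (T : measurableType d) (P : probability T R) (n : nat).
Variables (A : 'M[R]_n) (W x : 'I_n -> R -> T -> R).
Hypotheses (hW : white_noise_primitive P W) (hx : driven_state P A W x).

Local Notation mu := (@lebesgue_measure R).
Local Notation L2 := (square_integrable P setT).
Local Notation drift i s w := (\sum_(k < n) A i k * x k s w).

Let sub_slab (t : R) : `[0, t] `*` [set: T] `<=` [set s : R | 0 <= s] `*` [set: T].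
Proof. by move=> [s w] [/= + _]; rewrite in_itv/= => /andP[]. Qed.

Let measurable_slab : measurable ([set s : R | 0 <= s] `*` [set: T]).
Proof.
apply: measurableX => //.
by rewrite (_ : [set s | _] = `[0, +oo[%classic) //; rewrite set_itvE.
Qed.

Lemma measurable_section (f : R -> T -> R) (t : R) :
  measurable_fun ([set s : R | 0 <= s] `*` [set: T]) (fun p : R * T => f p.1 p.2) ->
  0 <= t -> measurable_fun setT (f t).
Proof.
move=> mf t0; apply: (measurable_comp measurable_slab _ mf
  (measurable_fun_pair (measurable_cst t) (@measurable_id _ T setT))).
by move=> _ [w _ <-].
Qed.

Lemma square_integrable_noise i (t : R) : 0 <= t -> L2 (W i t).
Proof.
move=> t0; split; first exact: measurable_section (wn_measurable hW i) t0.
have := wn_cov hW i i t0 t0; rewrite unlock eqxx minxx => h.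
by under eq_integral do rewrite expr2; rewrite h ltry.
Qed.

Lemma measurable_state i (t : R) :
  measurable_fun (`[0, t] `*` [set: T]) (fun p : R * T => x i p.1 p.2).
Proof. exact: measurable_funS (@sub_slab t) (st_measurable hx i). Qed.

Lemma square_integrable_state_slab i (t : R) : 0 <= t ->
  square_integrable (mu \x P)%E (`[0, t] `*` [set: T]) (fun p : R * T => x i p.1 p.2).
Proof.
move=> t0; split; first exact: measurable_state.
have -> := @tonelli_on1 _ _ _ _ _ mu P `[0, t]%classic (fun s w => x i s w ^+ 2).
- by have := st_square hx i t0; under eq_integral do rewrite unlock.
- by [].
- by apply: measurable_funX; exact: measurable_state.
- by move=> s w _; exact: sqr_ge0.
Qed.

Let mslab (t : R) : measurable (`[0, t]%classic `*` [set: T] : set (measurableTypeR R * T)).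
Proof. by apply: measurableX. Qed.

Lemma square_integrable_drift_slab i (t : R) : 0 <= t ->
  square_integrable (mu \x P)%E (`[0, t] `*` [set: T])
    (fun p : R * T => drift i p.1 p.2).
Proof.
move=> t0; refine (@square_integrable_sum _ _ _ (mu \x P)%E _ (mslab t) n
  (fun k p => A i k * x k p.1 p.2) _) => k.
refine (@square_integrableZ _ _ _ (mu \x P)%E _ (mslab t) _ _ _).
exact: square_integrable_state_slab.
Qed.

Lemma square_integrable_slab (Y : T -> R) (t : R) : 0 <= t -> L2 Y ->
  square_integrable (mu \x P)%E (`[0, t] `*` [set: T]) (fun p : R * T => Y p.2).
Proof.
move=> t0 [mY iY]; split.
  by apply: measurable_funS (measurableT_comp mY measurable_snd).
have -> := @tonelli_on1 _ _ _ _ _ mu P `[0, t]%classic (fun s w => Y w ^+ 2).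
- rewrite integral_cst//= lebesgue_measure_itv/= lte_fin.
  case: ifP => _; last by rewrite mule0.
  apply: lte_mul_pinfty => //; last by rewrite ltry.
    by apply: integral_ge0 => w _; rewrite lee_fin sqr_ge0.
  rewrite ge0_fin_numE//; apply: integral_ge0 => w _; rewrite lee_fin sqr_ge0//.
- by [].
- by apply: measurable_funX; apply: measurable_funS (measurableT_comp mY measurable_snd).
- by move=> s w _; exact: sqr_ge0.
Qed.

Let square_integrable_cst1 : L2 (cst 1).
Proof.
split; first exact: measurable_cst.
by under eq_integral do rewrite /= expr1n; rewrite integral_cst//= probability_setT mule1 ltry.
Qed.

Lemma ae_integrable_drift i (t : R) : 0 <= t ->
  {ae P, forall w, mu.-integrable `[0, t] (fun s => (drift i s w)%:E)}.
Proof.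
move=> t0.
have lf := square_integrable_drift_slab i t0.
apply: (@ae_integrable_fubini_on2 _ _ _ _ _ mu P `[0, t]%classic
  (fun s w => drift i s w) (measurable_itv _)).
(* The slab has finite measure, so square integrability gives integrability: multiply by the
   constant 1. *)
have := square_integrableM (mslab t) lf
  (square_integrable_slab t0 square_integrable_cst1).
by congr (integrable _ _ _); apply/funext => p /=; rewrite mulr1.
Qed.

Lemma state_noiseB i (t : R) : 0 <= t ->
  {ae P, forall w, x i t w - W i t w = \int[mu]_(s in `[0, t]) drift i s w}.
Proof.
move=> t0; apply: filterS (st_equation hx i t0) => w ->.
by rewrite addrK.
Qed.

(** [st_square] controls the second moment only after integration in time. The bound at a fixed time
    comes from the equation: x - W is a time integral of the drift, whose square is bounded path by
    path with [sqr_Rintegral_le]. *)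
Lemma square_integrable_state i (t : R) : 0 <= t -> L2 (x i t).
Proof.
move=> t0.
have mx := measurable_section (st_measurable hx i) t0.
have [mW _] := square_integrable_noise i t0.
suff lz : L2 (fun w => x i t w - W i t w).
  have := square_integrableD measurableT (square_integrable_noise i t0) lz.
  by congr (square_integrable _ _ _); apply/funext => w; rewrite addrC subrK.
have mz : measurable_fun setT (fun w => x i t w - W i t w) by exact: measurable_funB.
split => //.
have lf := square_integrable_drift_slab i t0.
have [mf _] := lf.
have mf2 : measurable_fun (`[0, t] `*` [set: T])
    (fun p : R * T => drift i p.1 p.2 ^+ 2) by exact: measurable_funX.
have f20 (s : R) (w : T) : `[0, t]%classic s -> 0 <= drift i s w ^+ 2.
  by move=> _; exact: sqr_ge0.
have if2 : (mu \x P)%E.-integrable (`[0, t] `*` [set: T])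
    (fun p => (drift i p.1 p.2 ^+ 2)%:E).
  exact: integrable_square_integrable lf.
refine (@le_lt_trans _ _
  (\int[P]_w (t%:E * \int[mu]_(s in `[0%R, t]) (drift i s w ^+ 2)%:E))%E _ _ _ _).
  apply: ae_ge0_le_integral => //.
  - by move=> w _; rewrite lee_fin sqr_ge0.
  - by apply/measurable_EFinP; exact: measurable_funX.
  - move=> w _; rewrite mule_ge0//; apply: integral_ge0 => s _.
    by rewrite lee_fin sqr_ge0.
  - apply: measurable_funeM.
    exact: (@measurable_tonelli_on2 _ _ _ _ _ mu `[0, t]%classic (fun s w => drift i s w ^+ 2)).
  - have i1 := ae_integrable_drift i t0.
    have i2 := @ae_integrable_fubini_on2 _ _ _ _ _ mu P `[0, t]%classic
      (fun s w => drift i s w ^+ 2) (measurable_itv _) if2.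
    have := state_noiseB i t0.
    apply: filterS3 i1 i2 => w i1 i2 zE _.
    rewrite zE -[X in (_ * X)%E]fineK; last exact: integrable_fin_num.
    rewrite -EFinM lee_fin.
    exact: sqr_Rintegral_le.
rewrite ge0_integralZl//.
- rewrite -(@tonelli_on2 _ _ _ _ _ mu P _ (fun s w => drift i s w ^+ 2))//.
  apply: lte_mul_pinfty => //.
  by case: lf.
- exact: (@measurable_tonelli_on2 _ _ _ _ _ mu `[0, t]%classic (fun s w => drift i s w ^+ 2)).
- by move=> w _; apply: integral_ge0 => s _; rewrite lee_fin sqr_ge0.
Qed.

Local Notation "''E2' ( X , Y )" := (\int[P]_w (X w * Y w)).

Lemma integrable_state_moment k (Y : T -> R) (t : R) : 0 <= t -> L2 Y ->
  mu.-integrable `[0, t] (fun s => ('E2(x k s, Y))%:E).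
Proof.
move=> t0 lY.
have lxY := square_integrableM (mslab t) (square_integrable_state_slab k t0)
  (square_integrable_slab t0 lY).
have h := @integrable_fubini_on1 _ _ _ _ _ mu P `[0, t]%classic
  (fun s w => x k s w * Y w) (measurable_itv _) lxY.
apply: eq_integrable h => //.
move=> s; rewrite inE /= in_itv /= => /andP[s0 _].
rewrite /Rintegral fineK//; apply: integrable_fin_num => //.
by apply: square_integrableM => //; exact: square_integrable_state.
Qed.

(** The state equation multiplied by [Y] and averaged, with the expectation moved inside the time
    integral by Fubini. The choices [Y = W j u] and [Y = x j u] give the Volterra equations for M
    and K. *)
Lemma state_moment i (Y : T -> R) (t : R) : 0 <= t -> L2 Y ->
  'E2(x i t, Y) =
  \int[mu]_(s in `[0, t]) (\sum_(k < n) A i k * 'E2(x k s, Y)) + 'E2(W i t, Y).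
Proof.
move=> t0 lY.
have lz : L2 (fun w => x i t w - W i t w).
  have := square_integrableD measurableT (square_integrable_state i t0)
    (square_integrableZ measurableT (-1) (square_integrable_noise i t0)).
  by congr (square_integrable _ _ _); apply/funext => w; rewrite mulN1r.
have lfY := square_integrableM (mslab t) (square_integrable_drift_slab i t0)
  (square_integrable_slab t0 lY).
have -> : 'E2(x i t, Y) = 'E2((fun w => x i t w - W i t w), Y) + 'E2(W i t, Y).
  rewrite -RintegralD//; last 2 first.
  - exact: square_integrableM.
  - by apply: square_integrableM => //; exact: square_integrable_noise.
  by apply: eq_Rintegral => w _; rewrite -mulrDl subrK.
congr (_ + _); congr fine.
transitivity (\int[P]_w \int[mu]_(s in `[0%R, t]) (drift i s w * Y w)%:E)%E.
  apply: ae_eq_integral => //.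
  - exact: measurable_int (square_integrableM measurableT lz lY).
  - exact: (@measurable_fubini_on2 _ _ _ _ _ mu P `[0, t]%classic (fun s w => drift i s w * Y w)).
  - have := ae_integrable_drift i t0; have := state_noiseB i t0.
    apply: filterS2 => w zE i1 _.
    rewrite zE -RintegralZr// /Rintegral fineK//.
    apply: integrable_fin_num => //.
    apply: eq_integrable (integrableZr _ (Y w) i1) => //.
rewrite -(@fubini_on _ _ _ _ _ mu P `[0, t]%classic (fun s w => drift i s w * Y w))//.
apply: eq_integral => s; rewrite inE /= in_itv /= => /andP[s0 _].
have lxY k : P.-integrable setT (EFin \o (fun w => x k s w * Y w)).
  by apply: square_integrableM => //; exact: square_integrable_state.
rewrite -sumEFin.
transitivity (\int[P]_w (\sum_(k < n) ((A i k)%:E * (x k s w * Y w)%:E)))%E.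
  apply: eq_integral => w _; rewrite mulr_suml -sumEFin.
  by apply: eq_bigr => k _; rewrite -EFinM mulrA.
rewrite integral_sum//; last first.
  by move=> k; apply: integrableZl => //; exact: lxY.
apply: eq_bigr => k _; rewrite integralZl//; last exact: lxY.
rewrite EFinM /Rintegral fineK//; apply: integrable_fin_num => //; exact: lxY.
Qed.

End second_moments.

(** * Linear differential and integral equations *)

Section derivatives.
Variable R : realType.
Implicit Types (f g : R -> R) (x df dg k : R).

Lemma is_derive_mulf f g x df dg : is_derive x 1 f df -> is_derive x 1 g dg ->
  is_derive x 1 (fun s => f s * g s) (f x * dg + g x * df).
Proof. exact: is_deriveM. Qed.

Lemma is_derive_addf f g x df dg : is_derive x 1 f df -> is_derive x 1 g dg ->
  is_derive x 1 (fun s => f s + g s) (df + dg).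
Proof. exact: is_deriveD. Qed.

Lemma is_derive_sumf n (h : 'I_n -> R -> R) x (dh : 'I_n -> R) :
  (forall i, is_derive x 1 (h i) (dh i)) ->
  is_derive x 1 (fun s => \sum_(i < n) h i s) (\sum_(i < n) dh i).
Proof.
move=> hd; rewrite (_ : (fun s => _) = \sum_(i < n) h i); first exact: is_derive_sum.
by apply/funext => s; rewrite fct_sumE.
Qed.

Lemma is_derive_scalef f x df k : is_derive x 1 f df ->
  is_derive x 1 (fun s => k * f s) (k * df).
Proof. exact: is_deriveZ. Qed.

Lemma is_derive_affine_comp f df k b x : is_derive (b + k * x) 1 f df ->
  is_derive x 1 (fun s => f (b + k * s)) (k * df).
Proof.
move=> fd.
have gd : is_derive x 1 (fun s : R => b + k * s) k.
  have := is_derive_addf (is_derive_cst b x 1) (is_derive_scalef k (is_derive_id x 1)).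
  by rewrite add0r mulr1.
by have := @is_derive1_comp _ f (fun s => b + k * s) _ _ _ fd gd; rewrite /GRing.scale/= mulrC.
Qed.

Lemma cvg_sumf (T I : Type) (F : set_system T) {FF : Filter F} (r : seq I)
    (h : I -> T -> R) (l : I -> R) :
  (forall i, h i s @[s --> F] --> l i) ->
  \sum_(i <- r) h i s @[s --> F] --> \sum_(i <- r) l i.
Proof.
move=> hl; elim: r => [|i r ih].
  by rewrite big_nil; under eq_fun do rewrite big_nil; exact: cvg_cst.
by rewrite big_cons; under eq_fun do rewrite big_cons; exact: cvgD.
Qed.

Lemma cvg_scalef (T : Type) (F : set_system T) {FF : Filter F} (h : T -> R) l k :
  h s @[s --> F] --> l -> k * h s @[s --> F] --> k * l.
Proof. by move=> hl; apply: cvgM => //; exact: cvg_cst. Qed.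

End derivatives.

(** * Decay of a weighted energy, and uniqueness *)

Section energy.
Variables (R : realType) (n : nat) (A : 'M[R]_n) (p : 'I_n -> R) (kappa : R).
Hypothesis energyA : forall v : 'I_n -> R,
  \sum_(i < n) p i * v i * (\sum_(k < n) A i k * v k) <=
  - kappa * \sum_(i < n) p i * v i ^+ 2.

Lemma energy_decay (y : 'I_n -> R -> R) (a b : R) : a <= b ->
  (forall i, {within `[a, b], continuous (y i)}) ->
  (forall s, a < s < b -> forall i,
     is_derive s 1 (y i) (\sum_(k < n) A i k * y k s)) ->
  \sum_(i < n) p i * y i b ^+ 2 <=
  expR (2 * kappa * (a - b)) * \sum_(i < n) p i * y i a ^+ 2.
Proof.
move=> ab yc yd.
(* The exponential offsets the decay rate, so [phi] is nonincreasing. The term [0 +] gives the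
   exponent the affine form of [is_derive_affine_comp]. *)
pose phi s := expR (0 + (2 * kappa) * s) * \sum_(i < n) p i * (y i s * y i s).
have dphi s : s \in `]a, b[ -> is_derive s 1 phi
    (expR (2 * kappa * s) *
     (2 * kappa * (\sum_(i < n) p i * (y i s * y i s)) +
      2 * \sum_(i < n) p i * y i s * \sum_(k < n) A i k * y k s)).
  rewrite in_itv/= => sab.
  pose dy i := \sum_(k < n) A i k * y k s.
  have := is_derive_mulf (is_derive_affine_comp (is_derive_expR (0 + (2 * kappa) * s)))
    (is_derive_sumf (fun i => is_derive_scalef (p i)
      (is_derive_mulf (yd s sab i) (yd s sab i)))).
  move=> /is_derive_eq; apply; rewrite /= add0r [RHS]mulrDr addrC; congr (_ + _).
    by ring.
  congr (_ * _); rewrite mulr_sumr; apply: eq_bigr => i _.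
  by rewrite -mulr2n -mulr_natl; ring.
have phi_b : phi b <= phi a.
  apply: (@ler0_derive1_nincr _ phi a b _ _ _ a b (lexx a) ab (lexx b)).
  - by move=> s sab; have [] := dphi s sab.
  - move=> s sab; rewrite derive1E; have [_ ->] := dphi s sab.
    rewrite pmulr_rle0 ?expR_gt0//.
    have := energyA (fun i => y i s).
    under [X in _ <= - kappa * X -> _]eq_bigr do rewrite expr2.
    by set q := \sum_(i < n) p i * (_ * _); set r := \sum_(i < n) _; lra.
  - apply/subspace_continuousP => s sab; apply: cvgM.
      apply: cvg_within_filter.
      apply: (@continuous_comp _ _ _ (fun s => 0 + 2 * kappa * s) expR);
        last exact: continuous_expR.
      by apply: cvgD; [exact: cvg_cst|apply: cvg_scalef; exact: cvg_id].
    apply: cvg_sumf => i; apply: cvg_scalef.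
    by have /subspace_continuousP/(_ s sab) h := yc i; apply: cvgM.
move: phi_b; rewrite /phi !add0r.
under eq_bigr do rewrite -expr2.
under [X in _ <= _ * X -> _]eq_bigr do rewrite -expr2.
rewrite mulrBr expRD expRN => h.
rewrite -(ler_pM2l (expR_gt0 (2 * kappa * b))) (le_trans h)//.
by rewrite mulrA [X in _ <= X * _]mulrC divfK// gt_eqF ?expR_gt0.
Qed.

Lemma energy_uniq (y : 'I_n -> R -> R) (a b : R) : (forall i, 0 < p i) -> a <= b ->
  (forall i, {within `[a, b], continuous (y i)}) ->
  (forall s, a < s < b -> forall i,
     is_derive s 1 (y i) (\sum_(k < n) A i k * y k s)) ->
  (forall i, y i a = 0) -> forall i, y i b = 0.
Proof.
move=> p0 ab yc yd ya i; have := energy_decay ab yc yd.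
under [X in _ <= _ * X -> _]eq_bigr do rewrite ya expr0n mulr0.
rewrite big1_eq mulr0 => le0.
have ge0 j : true -> 0 <= p j * y j b ^+ 2 by rewrite mulr_ge0 ?sqr_ge0// ltW.
have /eqP : \sum_(i < n) p i * y i b ^+ 2 = 0.
  by apply/eqP; rewrite eq_le le0 sumr_ge0//= => j _; exact: ge0.
rewrite psumr_eq0// => /allP/(_ i); rewrite mem_index_enum => /(_ isT)/eqP/eqP.
by rewrite mulf_eq0 gt_eqF//= sqrf_eq0 => /eqP.
Qed.

End energy.

(** * Regularity of solutions of Volterra equations *)

Section integral_equation.
Variable R : realType.
Variables (h F g : R -> R) (T : R).
Hypotheses (hi : lebesgue_measure.-integrable `[0, T] (EFin \o h))
  (FE : forall s, 0 <= s <= T ->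
     F s = \int[lebesgue_measure]_(r in `[0, s]) h r + g s).

(** In the applications [h] is a linear image of the unknown itself, so the continuity gained here
    supplies the continuity of [h] that differentiability requires. *)
Lemma continuous_integral_equation : 0 <= T ->
  {within `[0, T], continuous g} -> {within `[0, T], continuous F}.
Proof.
move=> T0 gc.
have hc := parameterized_integral_continuous T0 hi.
have eqF : {in `[0, T]%classic,
    (fun s => \int[lebesgue_measure]_(r in `[0, s]) h r + g s) =1 F}.
  by move=> s /set_mem; rewrite /= in_itv/= => sT; rewrite -FE.
have /subspace_continuousP fc := within_continuousD hc gc.
apply/subspace_continuousP => s sT; have := fc s sT.
rewrite [X in _ --> X -> _](_ : _ = F s); last exact/eqF/mem_set.
apply: cvg_trans; apply: near_eq_cvg.
by near=> r; apply: (eqF r); apply/mem_set; near: r; exact: withinT.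
Unshelve. all: end_near.
Qed.

Lemma is_derive_integral_equation (s dg : R) : 0 < s < T ->
  {for s, continuous h} -> is_derive s 1 g dg -> is_derive s 1 F (h s + dg).
Proof.
move=> /andP[s0 sT] hc gd.
have [di de] := continuous_FTC1_closed sT hi s0 hc.
have dF : is_derive s 1
    (fun s => \int[lebesgue_measure]_(r in `[0, s]) h r + g s) (h s + dg).
  by apply: is_derive_addf; split; [exact: di|rewrite -derive1E; exact: de].
apply: near_eq_is_derive dF.
near=> r; rewrite FE//; apply/andP; split; apply: ltW.
  by near: r; exact: lt_nbhsr.
by near: r; exact: lt_nbhsl.
Unshelve. all: end_near.
Qed.

End integral_equation.

(** * Entrywise calculus of matrix-valued functions *)

Section matrix_calculus.
Variables (R : realType).

Definition mx_continuous m n (D : set R) (F : R -> 'M[R]_(m, n)) :=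
  forall i j, {within D, continuous (fun s => F s i j)}.

Definition mx_derive m n (F : R -> 'M[R]_(m, n)) (s : R) (G : 'M[R]_(m, n)) :=
  forall i j, is_derive s 1 (fun r => F r i j) (G i j).

Lemma mx_continuousP m n (D : set R) (F : R -> 'M[R]_(m, n)) :
  mx_continuous D F <->
  forall i j s, D s -> F r i j @[r --> within D (nbhs s)] --> F s i j.
Proof.
split => FC i j; last by apply/subspace_continuousP; exact: FC.
by move=> s Ds; move/subspace_continuousP : (FC i j); exact.
Qed.

Lemma mx_continuousW m n (D D' : set R) (F : R -> 'M[R]_(m, n)) : D `<=` D' ->
  mx_continuous D' F -> mx_continuous D F.
Proof. by move=> DD' Fc i j; exact: continuous_subspaceW DD' (Fc i j). Qed.

Lemma mx_continuous_cst m n D (C : 'M[R]_(m, n)) : mx_continuous D (fun=> C).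
Proof. by apply/mx_continuousP => i j s _; exact: cvg_cst. Qed.

Lemma mx_continuousD m n D (F G : R -> 'M[R]_(m, n)) :
  mx_continuous D F -> mx_continuous D G -> mx_continuous D (fun s => F s + G s).
Proof.
move=> /mx_continuousP Fc /mx_continuousP Gc; apply/mx_continuousP => i j s Ds.
by under eq_fun do rewrite mxE; rewrite mxE; apply: cvgD; [exact: Fc|exact: Gc].
Qed.

Lemma mx_continuous_mull m n q D (C : 'M[R]_(m, n)) (F : R -> 'M[R]_(n, q)) :
  mx_continuous D F -> mx_continuous D (fun s => C *m F s).
Proof.
move=> /mx_continuousP Fc; apply/mx_continuousP => i j s Ds.
under eq_fun do rewrite mxE; rewrite mxE; apply: cvg_sumf => k.
by apply: cvg_scalef; exact: Fc.
Qed.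

Lemma mx_continuous_tr m n D (F : R -> 'M[R]_(m, n)) :
  mx_continuous D F -> mx_continuous D (fun s => (F s)^T).
Proof.
move=> /mx_continuousP Fc; apply/mx_continuousP => i j s Ds.
by under eq_fun do rewrite mxE; rewrite mxE; exact: Fc.
Qed.

Lemma mx_continuous_mulr m n q D (C : 'M[R]_(n, q)) (F : R -> 'M[R]_(m, n)) :
  mx_continuous D F -> mx_continuous D (fun s => F s *m C).
Proof.
move=> Fc; rewrite (_ : (fun s => _) = fun s => (C^T *m (F s)^T)^T).
  by apply: mx_continuous_tr; apply: mx_continuous_mull; exact: mx_continuous_tr.
by apply/funext => s; rewrite trmx_mul !trmxK.
Qed.

Lemma mx_continuousN m n D (F : R -> 'M[R]_(m, n)) :
  mx_continuous D F -> mx_continuous D (fun s => - F s).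
Proof.
move=> /(mx_continuous_mull (C := - 1%:M)); congr mx_continuous.
by apply/funext => s; rewrite mulNmx mul1mx.
Qed.

(** Needed for the time shift r - s ([k = 1]) and the time reversal u - r ([k = -1]). *)
Lemma mx_continuous_affine m n (D D' : set R) (F : R -> 'M[R]_(m, n)) (b k : R) :
  (forall s, D s -> D' (b + k * s)) ->
  mx_continuous D' F -> mx_continuous D (fun s => F (b + k * s)).
Proof.
move=> DD' /mx_continuousP Fc; apply/mx_continuousP => i j s Ds.
apply: cvg_comp (Fc i j _ (DD' _ Ds)).
move=> S; rewrite /within /= => S_near.
have lc : {for s, continuous (fun r : R => b + k * r)}.
  by apply: cvgD; [exact: cvg_cst|apply: cvg_scalef; exact: cvg_id].
change (nbhs s (fun r => D r -> S (b + k * r))).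
have near_s : nbhs s (fun r => D' (b + k * r) -> S (b + k * r)) := lc _ S_near.
by apply: filterS near_s => r H Dr; apply: H; exact: DD'.
Qed.

Lemma mx_derive_cst m n (C : 'M[R]_(m, n)) s : mx_derive (fun=> C) s 0.
Proof. by move=> i j; rewrite mxE; exact: is_derive_cst. Qed.

Lemma mx_deriveD m n (F G : R -> 'M[R]_(m, n)) s dF dG :
  mx_derive F s dF -> mx_derive G s dG -> mx_derive (fun r => F r + G r) s (dF + dG).
Proof.
move=> Fd Gd i j; under eq_fun do rewrite mxE.
by rewrite mxE; exact: is_derive_addf.
Qed.

Lemma mx_derive_mull m n q (C : 'M[R]_(m, n)) (F : R -> 'M[R]_(n, q)) s dF :
  mx_derive F s dF -> mx_derive (fun r => C *m F r) s (C *m dF).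
Proof.
move=> Fd i j; under eq_fun do rewrite mxE.
by rewrite mxE; apply: is_derive_sumf => k; exact: is_derive_scalef.
Qed.

Lemma mx_derive_tr m n (F : R -> 'M[R]_(m, n)) s dF :
  mx_derive F s dF -> mx_derive (fun r => (F r)^T) s dF^T.
Proof. by move=> Fd i j; under eq_fun do rewrite mxE; rewrite mxE. Qed.

Lemma mx_derive_mulr m n q (C : 'M[R]_(n, q)) (F : R -> 'M[R]_(m, n)) s dF :
  mx_derive F s dF -> mx_derive (fun r => F r *m C) s (dF *m C).
Proof.
move=> Fd; rewrite (_ : (fun r => _) = fun r => (C^T *m (F r)^T)^T).
  rewrite -[dF *m C]trmxK trmx_mul.
  by apply: mx_derive_tr; apply: mx_derive_mull; exact: mx_derive_tr.
by apply/funext => r; rewrite trmx_mul !trmxK.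
Qed.

Lemma mx_deriveN m n (F : R -> 'M[R]_(m, n)) s dF :
  mx_derive F s dF -> mx_derive (fun r => - F r) s (- dF).
Proof.
move=> /(mx_derive_mull (- 1%:M)); rewrite mulNmx mul1mx; congr mx_derive.
by apply/funext => r; rewrite mulNmx mul1mx.
Qed.

Lemma mx_derive_affine m n (F : R -> 'M[R]_(m, n)) (b k s : R) dF :
  mx_derive F (b + k * s) dF -> mx_derive (fun r => F (b + k * r)) s (k *: dF).
Proof.
move=> Fd i j; rewrite mxE.
exact: (@is_derive_affine_comp _ (fun r => F r i j)).
Qed.

End matrix_calculus.

(** * Covariance of the state *)

Section covariance.
Variables (R : realType) (n : nat) (A X : 'M[R]_n) (p : 'I_n -> R) (kappa : R).
Hypotheses (p_gt0 : forall i, 0 < p i) (kappa_gt0 : 0 < kappa).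
Hypothesis energyA : forall v : 'I_n -> R,
  \sum_(i < n) p i * v i * (\sum_(k < n) A i k * v k) <=
  - kappa * \sum_(i < n) p i * v i ^+ 2.
Hypothesis lyapunovX : A *m X + X *m A^T + 1%:M = 0.

Local Notation mu := (@lebesgue_measure R).

Lemma mx_energy_uniq (F : R -> 'M[R]_n) (a b : R) : a <= b ->
  mx_continuous `[a, b] F -> (forall s, a < s < b -> mx_derive F s (A *m F s)) ->
  F a = 0 -> F b = 0.
Proof.
move=> ab Fc Fd Fa; apply/matrixP => i j; rewrite mxE.
apply: (energy_uniq energyA (y := fun i s => F s i j) p_gt0 ab).
- by move=> k; exact: Fc.
- by move=> s sab k; have := Fd s sab k j; rewrite mxE.
- by move=> k; rewrite Fa mxE.
Qed.

Variables M K : R -> R -> 'M[R]_n.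
Hypothesis M_int : forall u s i j, 0 <= u -> 0 <= s ->
  mu.-integrable `[0, s] (fun r => (M r u i j)%:E).
Hypothesis M_eq : forall u s i j, 0 <= u -> 0 <= s ->
  M s u i j = \int[mu]_(r in `[0, s]) (A *m M r u) i j +
              Num.min s u * (1%:M : 'M[R]_n) i j.
Hypothesis K_int : forall u s i j, 0 <= u -> 0 <= s ->
  mu.-integrable `[0, s] (fun r => (K r u i j)%:E).
(** The forcing term is E[W_i(s) x_j(u)], that is the (j, i) entry of [M u s]: hence the swapped
    times and indices. *)
Hypothesis K_eq : forall u s i j, 0 <= u -> 0 <= s ->
  K s u i j = \int[mu]_(r in `[0, s]) (A *m K r u) i j + M u s j i.

Lemma integrable_mulmx (Z : R -> 'M[R]_n) s i j :
  (forall k, mu.-integrable `[0, s] (fun r => (Z r k j)%:E)) ->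
  mu.-integrable `[0, s] (EFin \o (fun r => (A *m Z r) i j)).
Proof.
move=> Zi.
have -> : EFin \o (fun r => (A *m Z r) i j) =
    (fun r => (\sum_(k < n) (A i k)%:E * (Z r k j)%:E)%E).
  by apply/funext => r /=; rewrite mxE -sumEFin.
apply: integrable_sum => // k _; exact: integrableZl.
Qed.

Lemma M_continuous u s : 0 <= u -> 0 <= s -> mx_continuous `[0, s] (M^~ u).
Proof.
move=> u0 s0 i j.
apply: (continuous_integral_equation (h := fun r => (A *m M r u) i j)
  (g := fun r => Num.min r u * (1%:M : 'M[R]_n) i j)) => //.
- by apply: integrable_mulmx => k; exact: M_int.
- by move=> r /andP[r0 _]; exact: M_eq.
- apply: continuous_subspaceT => r; apply: cvgM; last exact: cvg_cst.
  by apply: continuous_min; [exact: cvg_id|exact: cvg_cst].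
Qed.

Let mulmx_continuous_pt (Z : R -> 'M[R]_n) s i j T :
  mx_continuous `[0, T] Z -> 0 < s < T -> {for s, continuous (fun r => (A *m Z r) i j)}.
Proof.
move=> Zc /andP[s0 sT]; have T0 := lt_trans s0 sT.
apply: within_continuous_continuous T0 _ _; last by rewrite in_itv/= s0 sT.
exact: mx_continuous_mull Zc _ _.
Qed.

(** Before time [u] the noise covariance min(s, u) grows with slope 1; afterwards it is constant and
    the equation becomes homogeneous. *)
Lemma M_derive_lt s u : 0 < s < u -> mx_derive (M^~ u) s (A *m M s u + 1%:M).
Proof.
move=> /andP[s0 su] i j; have u0 := ltW (lt_trans s0 su).
rewrite mxE.
apply: (is_derive_integral_equation (h := fun r => (A *m M r u) i j)
  (g := fun r => Num.min r u * (1%:M : 'M[R]_n) i j) (T := u)) => //.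
- by apply: integrable_mulmx => k; exact: M_int.
- by move=> r /andP[r0 _]; exact: M_eq.
- by rewrite s0.
- by apply: mulmx_continuous_pt (M_continuous u0 u0) _; rewrite s0.
- have gd : is_derive s 1 (fun r => (1%:M : 'M[R]_n) i j * r) ((1%:M : 'M[R]_n) i j).
    by have := is_derive_scalef ((1%:M : 'M[R]_n) i j) (is_derive_id s 1); rewrite mulr1.
  apply: near_eq_is_derive gd; near=> r; rewrite mulrC; congr (_ * _).
  by apply/esym/min_idPl/ltW; near: r; exact: lt_nbhsl.
Unshelve. all: end_near.
Qed.

Lemma M_derive_gt s u : 0 <= u < s -> mx_derive (M^~ u) s (A *m M s u).
Proof.
move=> /andP[u0 us] i j; have s0 := le_lt_trans u0 us.
(* The equation is used up to time [s + 1], so that [s] is an interior point. *)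
have s1 : s < s + 1 by rewrite ltrDl.
have s10 : 0 <= s + 1 by rewrite addr_ge0// ltW.
rewrite -[X in is_derive _ _ _ X]addr0.
apply: (is_derive_integral_equation (h := fun r => (A *m M r u) i j)
  (g := fun r => Num.min r u * (1%:M : 'M[R]_n) i j) (T := s + 1)) => //.
- by apply: integrable_mulmx => k; exact: M_int.
- by move=> r /andP[r0 _]; exact: M_eq.
- by rewrite s0.
- by apply: mulmx_continuous_pt (M_continuous u0 s10) _; rewrite s0.
- have := is_derive_cst (u * (1%:M : 'M[R]_n) i j) s 1; apply: near_eq_is_derive.
  near=> r; congr (_ * _).
  by apply/esym/min_idPr/ltW; near: r; exact: lt_nbhsr.
Unshelve. all: end_near.
Qed.

(** Since [E] below is the exponential of [s A], [N s] is the integral of this exponential over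
    [0, s]. *)
Let N s := M s s.

Lemma M0 u : 0 <= u -> M 0 u = 0.
Proof.
move=> u0; apply/matrixP => i j; rewrite M_eq// set_itv1 Rintegral_set1 add0r !mxE.
by rewrite min_l// mul0r.
Qed.

(** Causality: the state at time [s] is uncorrelated with the later increments of the noise. Up to
    time [s], [M^~ u] and [M^~ s] solve the same equation with the same initial value. *)
Lemma M_causal s u : 0 <= s <= u -> M s u = N s.
Proof.
move=> /andP[s0 su]; have u0 := le_trans s0 su.
apply/eqP; rewrite -subr_eq0; apply/eqP.
apply: (@mx_energy_uniq (fun r => M r u - M r s) 0 s) => //.
- by apply: mx_continuousD; [|apply: mx_continuousN]; exact: M_continuous.
- move=> r /andP[r0 rs].
  rewrite mulmxBr -[X in mx_derive _ _ (X - _)](addrK 1%:M) -addrA -opprD [1%:M + _]addrC.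
  by apply: mx_deriveD; [|apply: mx_deriveN]; apply: M_derive_lt; rewrite r0 ?(lt_le_trans rs).
- by rewrite !M0// subrr.
Qed.

Lemma N_continuous s : 0 <= s -> mx_continuous `[0, s] N.
Proof.
move=> s0; have /mx_continuousP Mc := M_continuous s0 s0.
apply/mx_continuousP => i j r /[dup] rs; rewrite /= in_itv /= => rs'.
rewrite -(M_causal rs').
apply: cvg_trans (Mc i j r rs); apply: near_eq_cvg.
near=> q; rewrite M_causal//.
have : `[0, s]%classic q by near: q; exact: withinT.
by rewrite /= in_itv.
Unshelve. all: end_near.
Qed.

Let E s := 1%:M + A *m N s.

Lemma N_derive s : 0 < s -> mx_derive N s (E s).
Proof.
move=> s0 i j.
have s1 : s < s + 1 by rewrite ltrDl.
have := @M_derive_lt s (s + 1); rewrite s0 => /(_ s1 i j).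
rewrite M_causal; last by rewrite (ltW s0) (ltW s1).
rewrite [_ *m _ + _]addrC; apply: near_eq_is_derive; near=> r.
rewrite M_causal//; apply/andP; split; apply: ltW.
  by near: r; exact: lt_nbhsr.
by near: r; exact: lt_nbhsl.
Unshelve. all: end_near.
Qed.

Lemma E_continuous s : 0 <= s -> mx_continuous `[0, s] E.
Proof.
move=> s0; apply: mx_continuousD; first exact: mx_continuous_cst.
by apply: mx_continuous_mull; exact: N_continuous.
Qed.

Lemma E_derive s : 0 < s -> mx_derive E s (A *m E s).
Proof.
move=> s0; rewrite -[X in mx_derive _ _ X]add0r.
apply: mx_deriveD; first exact: mx_derive_cst.
by apply: mx_derive_mull; exact: N_derive.
Qed.

Lemma N0 : N 0 = 0. Proof. exact: M0. Qed.

Lemma E0 : E 0 = 1%:M. Proof. by rewrite /E N0 mulmx0 addr0. Qed.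

(** The commutator of [A] and [E] satisfies F' = A F and vanishes at 0. *)
Lemma E_comm s : 0 <= s -> A *m E s = E s *m A.
Proof.
move=> s0; apply/eqP; rewrite -subr_eq0; apply/eqP.
apply: (@mx_energy_uniq (fun r => A *m E r - E r *m A) 0 s) => //.
- apply: mx_continuousD; first by apply: mx_continuous_mull; exact: E_continuous.
  by apply: mx_continuousN; apply: mx_continuous_mulr; exact: E_continuous.
- move=> r /andP[r0 rs]; rewrite mulmxBr (mulmxA A (E r) A).
  apply: mx_deriveD; first by apply: mx_derive_mull; exact: E_derive.
  by apply: mx_deriveN; apply: mx_derive_mulr; exact: E_derive.
- by rewrite E0 mulmx1 mul1mx subrr.
Qed.

(** After time [s] both sides satisfy F' = A F, because E(r) - E(r - s) = A (N(r) - N(r - s)); at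
    time [s] both equal [N s]. *)
Lemma M_future s u : 0 <= s <= u -> M u s = N u - N (u - s).
Proof.
move=> /andP[s0 su]; have u0 := le_trans s0 su.
apply/eqP; rewrite -subr_eq0; apply/eqP.
have -> : u - s = - s + 1 * u by rewrite mul1r addrC.
apply: (@mx_energy_uniq (fun r => M r s - (N r - N (- s + 1 * r))) s u) => //.
- apply: mx_continuousD.
    by apply: mx_continuousW (M_continuous s0 u0) => r /=;
      rewrite !in_itv/= => /andP[sr ->]; rewrite (le_trans s0).
  apply: mx_continuousN; apply: mx_continuousD.
    by apply: mx_continuousW (N_continuous u0) => r /=;
      rewrite !in_itv/= => /andP[sr ->]; rewrite (le_trans s0).
  apply: mx_continuousN; apply: mx_continuous_affine (N_continuous u0) => r /=.
  rewrite !in_itv/= mul1r => /andP[sr ru].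
  by rewrite addrC subr_ge0 sr/= lerBlDr (le_trans ru)// lerDl.
- move=> r /andP[sr ru].
  have -> : A *m (M r s - (N r - N (- s + 1 * r))) =
      A *m M r s - (E r - 1 *: E (- s + 1 * r)).
    by rewrite /E scale1r !mulmxBr; congr (_ - _); rewrite opprD addrACA subrr add0r.
  apply: mx_deriveD; first by apply: M_derive_gt; rewrite s0.
  apply: mx_deriveN; apply: mx_deriveD; first by apply: N_derive; exact: le_lt_trans sr.
  by apply: mx_deriveN; apply: mx_derive_affine; apply: N_derive; rewrite mul1r addrC subr_gt0.
- by rewrite mul1r addNr N0 subr0 subrr.
Qed.

Lemma K0 u : 0 <= u -> K 0 u = 0.
Proof.
move=> u0; apply/matrixP => i j; rewrite K_eq// set_itv1 Rintegral_set1 add0r.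
by rewrite M_future ?lexx//= subr0 subrr !mxE.
Qed.

Lemma K_continuous u : 0 <= u -> mx_continuous `[0, u] (K^~ u).
Proof.
move=> u0 i j.
apply: (continuous_integral_equation (h := fun r => (A *m K r u) i j)
  (g := fun r => (N u - N (u + -1 * r)) j i)) => //.
- by apply: integrable_mulmx => k; exact: K_int.
- by move=> r /[dup] ru /andP[r0 _]; rewrite K_eq// M_future// mulN1r.
- have gc : mx_continuous `[0, u] (fun r => N u - N (u + -1 * r)); last exact: gc.
  apply: mx_continuousD; first exact: mx_continuous_cst.
  apply: mx_continuousN; apply: mx_continuous_affine (N_continuous u0) => r /=.
  by rewrite !in_itv/= mulN1r subr_ge0 lerBlDr lerDl andbC.
Qed.

Lemma K_derive s u : 0 < s < u ->
  mx_derive (K^~ u) s (A *m K s u + (E (u - s))^T).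
Proof.
move=> /andP[s0 su] i j; have u0 := ltW (lt_trans s0 su).
rewrite mxE [X in _ + X]mxE.
apply: (is_derive_integral_equation (h := fun r => (A *m K r u) i j)
  (g := fun r => (N u - N (u + -1 * r)) j i) (T := u)) => //.
- by apply: integrable_mulmx => k; exact: K_int.
- by move=> r /[dup] ru /andP[r0 _]; rewrite K_eq// M_future// mulN1r.
- by rewrite s0.
- by apply: mulmx_continuous_pt (K_continuous u0) _; rewrite s0.
- have -> : E (u - s) = 0 - (-1 *: E (u + -1 * s)).
    by rewrite mulN1r scaleN1r opprK add0r.
  have gd : mx_derive (fun r => N u - N (u + -1 * r)) s
      (0 - (-1 *: E (u + -1 * s))); last exact: gd.
  apply: mx_deriveD; first exact: mx_derive_cst.
  by apply: mx_deriveN; apply: mx_derive_affine; apply: N_derive; rewrite mulN1r subr_gt0.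
Qed.

(** As functions of [s], both sides vanish at 0 and solve F' = A F + E(u - s)^T. For the right-hand
    side, [E_comm] turns the derivative of X E(u - s)^T into - X A^T E(u - s)^T, which the Lyapunov
    equation rewrites as (A X + 1) E(u - s)^T. *)
Lemma covarianceE s u : 0 <= s <= u ->
  K s u = X *m (E (u - s))^T - E s *m X *m (E u)^T.
Proof.
move=> /andP[s0 su]; have u0 := le_trans s0 su.
apply/eqP; rewrite -subr_eq0; apply/eqP.
have -> : u - s = u + -1 * s by rewrite mulN1r.
apply: (@mx_energy_uniq (fun r => K r u -
   (X *m (E (u + -1 * r))^T - E r *m X *m (E u)^T)) 0 s) => //.
- apply: mx_continuousD.
    by apply: mx_continuousW (K_continuous u0) => r /=;
      rewrite !in_itv/= => /andP[-> rs]; rewrite (le_trans rs).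
  apply: mx_continuousN; apply: mx_continuousD.
    apply: mx_continuous_mull; apply: mx_continuous_tr.
    apply: mx_continuous_affine (E_continuous u0) => r /=.
    rewrite !in_itv/= mulN1r subr_ge0 => /andP[r0 rs].
    by rewrite (le_trans rs)//= lerBlDr lerDl.
  by apply: mx_continuousN; do 2 apply: mx_continuous_mulr; exact: E_continuous.
- move=> r /andP[r0 rs]; have ru := lt_le_trans rs su.
  have ur : 0 < u + -1 * r by rewrite mulN1r subr_gt0.
  set F := E (u + -1 * r).
  have -> : A *m (K r u - (X *m F^T - E r *m X *m (E u)^T)) =
      (A *m K r u + F^T) - (X *m (-1 *: (A *m F))^T - A *m E r *m X *m (E u)^T).
    have cF : A *m F = F *m A by apply: E_comm; exact: ltW.
    have -> : X *m (-1 *: (A *m F))^T = - (X *m A^T *m F^T).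
      by rewrite scaleN1r linearN/= mulmxN cF trmx_mul mulmxA.
    have -> : A *m K r u + F^T =
        A *m K r u - (A *m X *m F^T + X *m A^T *m F^T).
      congr (_ + _).
      rewrite -mulmxDl -[LHS]mul1mx -mulNmx; congr (_ *m _).
      by apply/eqP; rewrite -addr_eq0 addrC lyapunovX.
    rewrite !mulmxBr !mulmxA.
    move: (A *m K r u) (A *m X *m F^T) (X *m A^T *m F^T) (A *m E r *m X *m (E u)^T) => M1 M2 M3 M4.
    by apply/matrixP => k l; rewrite !mxE; ring.
  apply: mx_deriveD.
    by rewrite /F mulN1r; apply: K_derive; rewrite r0 ru.
  apply: mx_deriveN; apply: mx_deriveD.
    apply: mx_derive_mull; apply: mx_derive_tr; apply: mx_derive_affine.
    exact: E_derive.
  by apply: mx_deriveN; do 2 apply: mx_derive_mulr; exact: E_derive.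
- by rewrite K0// mulr0 addr0 E0 mul1mx subrr subr0.
Qed.

Lemma E_decay i j : E s i j @[s --> +oo] --> 0.
Proof.
(* One weighted square is at most the energy of column [j]; dividing by its weight gives the factor
   [(p i)^-1]. *)
pose C := (p i)^-1 * \sum_(k < n) p k * (E 0) k j ^+ 2.
have Ebound s : 0 < s -> E s i j ^+ 2 <= C * expR (- (2 * kappa * s)).
  move=> s0; rewrite /C -[X in _ <= X]mulrA ler_pdivlMl//.
  rewrite [leRHS]mulrC.
  have := @energy_decay _ _ A p kappa energyA (fun i s => E s i j) 0 s (ltW s0).
  rewrite sub0r mulrN => H; apply: le_trans (H _ _); first last.
  - by move=> r /andP[r0 _] k; have := E_derive r0 k j; rewrite mxE.
  - by move=> k; exact: E_continuous (ltW s0) k j.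
  rewrite (bigD1 i)//= lerDl sumr_ge0// => k _.
  by rewrite mulr_ge0 ?sqr_ge0// ltW.
have expy : C * expR (- (2 * kappa * s)) @[s --> +oo] --> 0.
  rewrite -[X in _ --> X](mulr0 C); apply: cvg_scalef.
  apply: (@cvg_comp _ _ _ (fun s => 2 * kappa * s) (fun s => expR (- s))); last exact: cvgr_expR.
  by apply: gt0_cvgMry; [rewrite mulr_gt0|exact: cvg_id].
apply/cvgrPdist_lt => e e0; near=> s.
rewrite sub0r normrN -(@ltr_pXn2r _ 2)// ?nnegrE ?normr_ge0 ?(ltW e0)// real_normK ?num_real//.
apply: (@le_lt_trans _ _ (C * expR (- (2 * kappa * s)))).
  by apply: Ebound; near: s; apply: nbhs_pinfty_gt; exact: num_real.
rewrite (le_lt_trans (ler_norm _))// -normrN -sub0r.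
near: s; have /cvgrPdist_lt := expy; apply.
by rewrite exprn_gt0.
Unshelve. all: end_near.
Qed.

Lemma trace_covariance_cvg : \sum_(i < n) K s s i i @[s --> +oo] --> \tr X.
Proof.
(* The limit is written with the entries of [E] replaced by 0, the shape in which limits are taken
   term by term. *)
rewrite -[X in _ --> X]subr0 -[X in _ - X](@big1 _ 0 +%R _ (index_enum 'I_n) xpredT
  (fun i => \sum_(k < n) (\sum_(l < n) 0 * X l k) * 0)); last first.
  by move=> i _; rewrite big1// => k _; rewrite mulr0.
apply: cvg_trans (_ : ((\tr X - \sum_(i < n) \sum_(k < n)
    (\sum_(l < n) E s i l * X l k) * E s i k) @[s --> +oo]) `=>` _).
  apply: near_eq_cvg; near=> s.
  have s0 : 0 <= s by near: s; apply: nbhs_pinfty_ge; exact: num_real.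
  rewrite /mxtrace -sumrB; apply: eq_bigr => i _.
  rewrite covarianceE ?s0 ?lexx// subrr E0 trmx1 mulmx1 !mxE; congr (_ - _).
  by apply: eq_bigr => k _; rewrite !mxE.
apply: cvgB; first exact: cvg_cst.
apply: cvg_sumf => i; apply: cvg_sumf => k; apply: cvgM; last exact: E_decay.
by apply: cvg_sumf => l; apply: cvgM; [exact: E_decay|exact: cvg_cst].
Unshelve. all: end_near.
Qed.

End covariance.

(** The processes enter only through their moment matrices, which meet the assumptions on [M] and
    [K] by [state_moment] and [integrable_state_moment]. *)
Lemma is_rho_ss_trace (R : realType) (n : nat) (A X : 'M[R]_n)
    (p : 'I_n -> R) (kappa : R) :
  (forall i, 0 < p i) -> 0 < kappa ->
  (forall v : 'I_n -> R,
    \sum_(i < n) p i * v i * (\sum_(k < n) A i k * v k) <=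
    - kappa * \sum_(i < n) p i * v i ^+ 2) ->
  A *m X + X *m A^T + 1%:M = 0 -> is_rho_ss A 1%:M (\tr X).
Proof.
move=> p_gt0 kappa_gt0 energyA lyapX d T P W x hW hx.
have L2W := square_integrable_noise hW.
have L2x := square_integrable_state hW hx.
pose M s u : 'M[R]_n := \matrix_(i, j) \int[P]_w (x i s w * W j u w).
pose K s u : 'M[R]_n := \matrix_(i, j) \int[P]_w (x i s w * x j u w).
have trE : (\sum_(i < n) K s s i i)%:E @[s --> +oo] --> (\tr X)%:E.
  apply: cvg_EFin; first by near=> s.
  apply: (@trace_covariance_cvg _ _ A X p kappa p_gt0 kappa_gt0 energyA lyapX M K).
  - move=> u s i j u0 s0; rewrite (_ : (fun r => _) = fun r => (\int[P]_w (x i r w * W j u w))%:E);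
      last by apply/funext => r; rewrite mxE.
    apply: (integrable_state_moment hW hx) => //; exact: L2W.
  - move=> u s i j u0 s0; rewrite mxE (state_moment hW hx)//; last exact: L2W.
    congr (_ + _).
      apply: eq_Rintegral => r _ /=; rewrite mxE; apply: eq_bigr => k _.
      by rewrite mxE.
    rewrite mxE /Rintegral.
    have := wn_cov hW i j s0 u0; rewrite unlock => ->.
    by case: eqP; rewrite ?mulr1 ?mulr0.
  - move=> u s i j u0 s0; rewrite (_ : (fun r => _) = fun r => (\int[P]_w (x i r w * x j u w))%:E);
      last by apply/funext => r; rewrite mxE.
    by apply: (integrable_state_moment hW hx) => //; exact: L2x.
  - move=> u s i j u0 s0; rewrite mxE (state_moment hW hx)//; last exact: L2x.
    congr (_ + _).
      apply: eq_Rintegral => r _ /=; rewrite mxE; apply: eq_bigr => k _.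
      by rewrite mxE.
    by rewrite mxE; apply: eq_Rintegral => w _; rewrite mulrC.
(* The power equals the trace of [K s s] only for [s >= 0], which suffices for a limit at
   infinity. *)
apply: cvg_trans trE; apply: near_eq_cvg; near=> s.
have s0 : 0 <= s by near: s; apply: nbhs_pinfty_ge; exact: num_real.
rewrite /output_power expectation.unlock.
have lxx i : P.-integrable setT (EFin \o (fun w => x i s w * x i s w)).
  by apply: square_integrableM => //; exact: L2x.
transitivity (\int[P]_w (\sum_(i < n) (x i s w * x i s w)%:E))%E; last first.
  apply: eq_integral => w _; rewrite sumEFin; congr EFin; apply: eq_bigr => i _.
  rewrite (bigD1 i)//= mxE eqxx mulr1 big1 ?addr0// => j ji.
  by rewrite mxE eq_sym (negbTE ji) mulr0 mul0r.
rewrite integral_sum//.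
rewrite -sumEFin; apply: eq_bigr => i _.
by rewrite mxE /Rintegral fineK//; apply: integrable_fin_num => //; exact: lxx.
Unshelve. all: end_near.
Qed.

(** * Discrete Wirtinger inequality and diagonal stability *)

Section wirtinger.
Variables (R : realType) (th : R).
Local Notation s k := (sin (k%:R * th)).

Let s0 : s 0 = 0. Proof. by rewrite mul0r sin0. Qed.

Let sS k : s k.+1 = s k * cos th + cos (k%:R * th) * sin th.
Proof. by rewrite -natr1 mulrDl mul1r sinD. Qed.

Lemma sin_mul_recurrence k : s k.+2 = 2 * cos th * s k.+1 - s k.
Proof.
have -> : s k.+2 = s k.+1 * cos th + (cos (k%:R * th) * cos th - s k * sin th) * sin th.
  by rewrite sS; congr (_ + _ * _); rewrite -natr1 mulrDl mul1r cosD.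
rewrite sS.
have := cos2Dsin2 th; set x := s k; set y := cos (_ * _).
set u := cos th; set v := sin th => h.
transitivity (2 * u * (x * u + y * v) - x + x * (1 - (u ^+ 2 + v ^+ 2))); first by ring.
by rewrite h subrr mulr0 addr0.
Qed.

(** This quadratic form is a first integral of the recurrence; its constancy makes the completion of
    squares in the path inequality exact. *)
Let sin_mul_quadratic k :
  s k ^+ 2 + s k.+1 ^+ 2 - 2 * cos th * s k * s k.+1 = sin th ^+ 2.
Proof.
rewrite sS; have := cos2Dsin2 th; have := cos2Dsin2 (k%:R * th).
set x := s k; set y := cos (_ * _); set u := cos th; set v := sin th => h1 h2.
transitivity (v ^+ 2 + v ^+ 2 * (y ^+ 2 + x ^+ 2 - 1) - x ^+ 2 * (u ^+ 2 + v ^+ 2 - 1)).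
  by ring.
by rewrite h1 h2 subrr !mulr0 addr0 subr0.
Qed.

(* The partial forms are completed to squares by the positive solution
   [sin (k * th)] of [s (k+2) + s k = 2 cos th * s (k+1)]. *)
Lemma path_wirtinger (y : nat -> R) j : (forall k, (k <= j)%N -> 0 < s k.+1) ->
  ((y j.+1) ^+ 2 + y 0%N ^+ 2) * (s j.+2 / s j.+1) -
    2 * y 0%N * y j.+1 * (sin th / s j.+1) <=
  2 * cos th * (\sum_(k < j.+2) y k ^+ 2) - 2 * \sum_(k < j.+1) y k * y k.+1.
Proof.
elim: j => [|j ih] spos.
  have s1 := spos 0%N isT.
  rewrite sin_mul_recurrence s0 !big_ord_recl !big_ord0 /= /bump /= !mul1r.
  move: s1; rewrite mul1r => s1; rewrite subr0 mulfK ?gt_eqF// divff ?gt_eqF//.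
  by rewrite le_eqVlt; apply/orP; left; apply/eqP; ring.
have sj := spos j (leqnSn j); have sj1 := spos j.+1 (leqnn _).
have {}ih := ih (fun k kj => spos k (leqW kj)).
rewrite big_ord_recr [X in _ - 2 * X]big_ord_recr /=.
rewrite (sin_mul_recurrence j.+1).
have q := sin_mul_quadratic j.+1.
(* This square is exactly what is lost in passing from one lower bound to the next, that is in
   minimizing over [y j.+1]. *)
have sq : 0 <= (y j.+1 * s j.+2 - y j.+2 * s j.+1 - y 0%N * sin th) ^+ 2 /
   (s j.+1 * s j.+2) by rewrite divr_ge0 ?sqr_ge0// ltW// mulr_gt0.
move: ih q sq sj sj1.
set S1 := \sum_(_ < _) _; set S2 := \sum_(_ < _) _.
move: (s j.+1) (s j.+2) (sin th) (cos th) (y j.+1) (y j.+2) (y 0%N) => u v w k y1 y2 y0.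
move=> ih q sq u0 v0.
have u1 : u != 0 by rewrite gt_eqF.
have v1 : v != 0 by rewrite gt_eqF.
have -> : (y2 ^+ 2 + y0 ^+ 2) * ((2 * k * v - u) / v) - 2 * y0 * y2 * (w / v) =
  ((y1 ^+ 2 + y0 ^+ 2) * (v / u) - 2 * y0 * y1 * (w / u)) +
  (2 * k * y2 ^+ 2 - 2 * (y1 * y2)) -
  (y1 * v - y2 * u - y0 * w) ^+ 2 / (u * v) +
  y0 ^+ 2 * (w ^+ 2 - (u ^+ 2 + v ^+ 2 - 2 * k * u * v)) / (u * v).
  by field; rewrite u1 v1.
rewrite q subrr mulr0 mul0r addr0.
lra.
Qed.

End wirtinger.

(** The angle pi / (m + 1) is the one for which the sines stay positive along the path and vanish
    just after it. The square terms of [path_wirtinger] then disappear, and the remaining cross term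
    is the closing edge with its minus sign. *)
Lemma cyclic_wirtinger (R : realType) (m : nat) (y : nat -> R) : (0 < m)%N ->
  \sum_(k < m) y k * y k.+1 - y m * y 0%N <=
  cos (pi / m.+1%:R) * \sum_(k < m.+1) y k ^+ 2.
Proof.
case: m => // j _; set th := pi / _.
have thE : j.+2%:R * th = pi by rewrite mulrC divfK// pnatr_eq0.
have th0 : 0 < th by rewrite divr_gt0 ?pi_gt0// ltr0n.
have spos k : (k <= j)%N -> 0 < sin (k.+1%:R * th).
  move=> kj; apply: sin_gt0_pi; rewrite mulr_gt0 ?ltr0n//= -thE.
  by rewrite ltr_pM2r// ltr_nat !ltnS.
have := path_wirtinger y spos.
have s1 : sin (j.+1%:R * th) = sin th.
  have -> : j.+1%:R * th = pi - th by rewrite -thE -[j.+2%:R]natr1 mulrDl mul1r addrK.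
  by rewrite sinB sinpi cospi mul0r mulN1r sub0r opprK.
rewrite thE sinpi mul0r mulr0 sub0r s1 divff; last first.
  by rewrite -s1 gt_eqF// spos.
set S1 := \sum_(_ < _) _; set S2 := \sum_(_ < _) _; lra.
Qed.

(** The morphism [f] covers both the real matrix ([idfun]) and its complexification
    ([real_complex R]). *)
Lemma cyclic_mx_row (R : realType) (K : pzRingType) (f : {rmorphism R -> K})
    (m : nat) (a c : 'I_m.+2 -> R) (v : 'I_m.+2 -> K) (i : 'I_m.+2) :
  \sum_(k < m.+2) f (cyclic_mx a c i k) * v k =
  - f (a i) * v i + (if (i == 0 :> nat)%N then - f (c ord_max) * v ord_max
                     else f (c (inord i.-1)) * v (inord i.-1)).
Proof.
rewrite (bigD1 i)//= mxE eqxx rmorphN; congr (_ + _).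
case: eqP => [i0|/eqP i0].
  rewrite (bigD1 ord_max)/=; last by rewrite -val_eqE /= i0.
  rewrite mxE -val_eqE /= i0 /= eqxx rmorphN big1 ?addr0// => k /andP[ki km].
  rewrite mxE -val_eqE /= eq_sym; move: ki km; rewrite -!val_eqE /= i0 => /negbTE -> /negbTE ->.
  by rewrite rmorph0 mul0r.
have i1 : (i.-1 < m.+2)%N by rewrite (leq_ltn_trans (leq_pred _)).
have iE : (inord i.-1 : 'I_m.+2) = i.-1 :> nat by rewrite inordK.
rewrite (bigD1 (inord i.-1))/=; last first.
  by rewrite -val_eqE /= iE -[X in _ != X]prednK ?lt0n// neq_ltn ltnS leqnn.
rewrite mxE -val_eqE /= iE prednK ?lt0n// eqxx.
have -> : (i == i.-1 :> nat)%N = false.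
  by apply/negbTE; rewrite -[X in X != _]prednK ?lt0n// neq_ltn ltnS leqnn orbT.
rewrite big1 ?addr0// => k /andP[ki km].
rewrite mxE -val_eqE /= eq_sym; move: ki km; rewrite -!val_eqE /= iE => /negbTE -> km.
have -> : (i == k.+1 :> nat)%N = false.
  by apply/negbTE; apply: contra km => /eqP ->.
by rewrite (negbTE i0) rmorph0 mul0r.
Qed.

(** * Diagonal Lyapunov function of the cyclic network *)

Section cyclic_energy.
Variables (R : realType) (m : nat) (a c : 'I_m.+2 -> R) (r : R).
Hypotheses (a_gt0 : forall i, 0 < a i) (c_gt0 : forall i, 0 < c i).
Hypotheses (r_gt0 : 0 < r)
  (rE : r ^+ m.+2 * \prod_(i < m.+2) a i = \prod_(i < m.+2) c i).

Let an k := a (inord k).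
Let cn k := c (inord k).
(** With [y k = e k * v k] and weights [e k ^+ 2 / a k], decay contributes minus the sum of
    [y k ^+ 2], and this choice of ratios makes every coupling along the path equal to
    [r * y k * y k.+1]. *)
Let e k := \prod_(j < k) (an j.+1 * r / cn j).

Let an_gt0 k : 0 < an k. Proof. exact: a_gt0. Qed.
Let cn_gt0 k : 0 < cn k. Proof. exact: c_gt0. Qed.

Let e_gt0 k : 0 < e k.
Proof. by apply: prodr_gt0 => j _; rewrite divr_gt0// mulr_gt0. Qed.

Let eS k : e k.+1 * cn k = e k * an k.+1 * r.
Proof. by rewrite /e big_ord_recr /= -[LHS]mulrA divfK ?gt_eqF// mulrA. Qed.

(** The recurrence for [e] returns to [e 0 = 1] after a full turn; this periodicity is what [rE]
    expresses, and it gives the closing edge the same coefficient [r]. *)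
Let e_last : e m.+1 * r * an 0 = cn m.+1.
Proof.
have prodn (u : 'I_m.+2 -> R) : \prod_(i < m.+2) u i = \prod_(i < m.+2) u (inord i).
  by apply: eq_bigr => i _; rewrite inord_val.
have eE k : e k * \prod_(j < k) cn j = r ^+ k * \prod_(j < k) an j.+1.
  elim: k => [|k ih]; first by rewrite /e !big_ord0 mulr1.
  rewrite [\prod_(_ < k.+1) cn _]big_ord_recr [\prod_(_ < k.+1) an _]big_ord_recr /=.
  transitivity ((e k.+1 * cn k) * \prod_(j < k) cn j); first by ring.
  rewrite eS exprS; transitivity ((e k * \prod_(j < k) cn j) * an k.+1 * r); first by ring.
  by rewrite ih; ring.
have P0 : 0 < \prod_(j < m.+1) cn j by apply: prodr_gt0.
apply: (mulIf (lt0r_neq0 P0)).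
transitivity (e m.+1 * \prod_(j < m.+1) cn j * r * an 0); first by ring.
have rE' : r ^+ m.+2 * (an 0 * \prod_(j < m.+1) an j.+1) =
    (\prod_(j < m.+1) cn j) * cn m.+1.
  move: rE; rewrite prodn [\prod_(i < _) c i]prodn [\prod_(i < m.+2) c _]big_ord_recr.
  rewrite big_ord_recl => <-; congr (_ * (_ * _)).
by rewrite eE [RHS]mulrC -rE' [r ^+ m.+2]exprS; ring.
Qed.

Definition cyclic_weight (i : 'I_m.+2) : R := e i ^+ 2 / a i.

Lemma cyclic_weight_gt0 i : 0 < cyclic_weight i.
Proof. by rewrite divr_gt0// exprn_gt0. Qed.

Lemma cyclic_energy (v : 'I_m.+2 -> R) :
  \sum_(i < m.+2) cyclic_weight i * v i * (\sum_(k < m.+2) cyclic_mx a c i k * v k) <=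
  - (1 - r * cos (pi / m.+2%:R)) * \sum_(i < m.+2) a i * (cyclic_weight i * v i ^+ 2).
Proof.
pose y k := e k * v (inord k).
have -> : \sum_(i < m.+2) a i * (cyclic_weight i * v i ^+ 2) = \sum_(k < m.+2) y k ^+ 2.
  apply: eq_bigr => i _; rewrite /y inord_val /cyclic_weight.
  by field; rewrite gt_eqF.
have -> : \sum_(i < m.+2) cyclic_weight i * v i * (\sum_(k < m.+2) cyclic_mx a c i k * v k) =
    r * (\sum_(k < m.+1) y k * y k.+1 - y m.+1 * y 0%N) - \sum_(k < m.+2) y k ^+ 2.
  under eq_bigr do rewrite (cyclic_mx_row idfun) mulrDr.
  rewrite big_split /= addrC; congr (_ + _); last first.
    rewrite -sumrN; apply: eq_bigr => i _; rewrite /y inord_val /cyclic_weight.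
    by field; rewrite gt_eqF.
  rewrite big_ord_recl /= addrC mulrBr; congr (_ + _).
    rewrite mulr_sumr; apply: eq_bigr => k _.
    rewrite /cyclic_weight /y lift0 /=.
    have -> : lift ord0 k = inord k.+1 :> 'I_m.+2.
      by apply: val_inj; rewrite /= inordK ?ltnS//; case: k.
    rewrite -/(an k.+1) -/(cn k).
    have := eS k => h.
    transitivity (e k.+1 * (e k.+1 * cn k) / an k.+1 * v (inord k.+1) * v (inord k)).
      by field; rewrite gt_eqF.
    by rewrite h; field; rewrite gt_eqF.
  have -> : (ord_max : 'I_m.+2) = inord m.+1 by apply: val_inj; rewrite /= inordK.
  have -> : (ord0 : 'I_m.+2) = inord 0 by apply: val_inj; rewrite /= inordK.
  rewrite /cyclic_weight /y inordK// -/(an 0) -/(cn m.+1) -e_last /e big_ord0.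
  by field; rewrite gt_eqF.
have := cyclic_wirtinger y (ltn0Sn m); rewrite -(ler_pM2l r_gt0).
set S1 := \sum_(_ < _) _ ^+ 2; set S2 := \sum_(_ < _) _; nra.
Qed.

End cyclic_energy.

Lemma geometric_mean_gt0 (R : realType) n (u : 'I_n -> R) :
  (forall i, 0 < u i) -> 0 < geometric_mean u.
Proof. by move=> u0; apply/powR_gt0/prodr_gt0. Qed.

Lemma geometric_meanX (R : realType) n (u : 'I_n -> R) : (0 < n)%N ->
  (forall i, 0 < u i) -> geometric_mean u ^+ n = \prod_(i < n) u i.
Proof.
move=> n0 u0; rewrite -powR_mulrn ?powR_ge0// -powRrM mulVf ?pnatr_eq0 -?lt0n//.
by rewrite powRr1// ltW// prodr_gt0.
Qed.

Lemma char_poly_tr (R : comNzRingType) n (A : 'M[R]_n) : char_poly A^T = char_poly A.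
Proof.
rewrite /char_poly -det_tr; congr (\det _).
by apply/matrixP => i j; rewrite !mxE eq_sym.
Qed.

(** Adding the inequalities for the real and imaginary parts of an eigenvector cancels the terms in
    [Im l]. Two families of weights occur because the cyclic estimate dissipates with the weights
    [a i * p i]. *)
Lemma hurwitz_energy (R : realType) (n : nat) (A : 'M[R]_n) (p q : 'I_n -> R)
    (delta : R) : (forall i, 0 < p i) -> (forall i, 0 < q i) -> 0 < delta ->
  (forall v : 'I_n -> R,
    \sum_(i < n) p i * v i * (\sum_(k < n) A i k * v k) <=
    - delta * \sum_(i < n) q i * v i ^+ 2) -> hurwitz A.
Proof.
move=> p0 q0 delta0 energyA l.
(* Eigenvectors are row vectors by convention; an eigenvector of the transpose is a column
   eigenvector of [A]. *)
rewrite eigenvalue_root_char -char_poly_tr -eigenvalue_root_char.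
move=> /eigenvalueP[v vA v0].
pose x i := complex.Re (v 0 i); pose y i := complex.Im (v 0 i).
have Av i : \sum_(k < n) (A i k)%:C%C * v 0 k = l * v 0 i.
  move/rowP/(_ i) : vA; rewrite !mxE => <-; apply: eq_bigr => k _.
  by rewrite !mxE mulrC.
have reM (s : R) (z : complex R) : complex.Re (s%:C%C * z) = s * complex.Re z.
  by case: z => z1 z2 /=; rewrite mul0r subr0.
have imM (s : R) (z : complex R) : complex.Im (s%:C%C * z) = s * complex.Im z.
  by case: z => z1 z2 /=; rewrite mul0r addr0.
have Ax i : \sum_(k < n) A i k * x k = complex.Re l * x i - complex.Im l * y i.
  rewrite /x /y; transitivity (complex.Re (l * v 0 i));
    last by case: l {vA Av} => ? ?; case: (v 0 i).
  by rewrite -Av raddf_sum; apply: eq_bigr => k _; exact/esym/reM.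
have Ay i : \sum_(k < n) A i k * y k = complex.Re l * y i + complex.Im l * x i.
  rewrite /x /y; transitivity (complex.Im (l * v 0 i));
    last by case: l {vA Av Ax} => ? ?; case: (v 0 i).
  by rewrite -Av raddf_sum; apply: eq_bigr => k _; exact/esym/imM.
have ex := energyA x; have ey := energyA y.
pose Q := \sum_(i < n) q i * x i ^+ 2 + \sum_(i < n) q i * y i ^+ 2.
pose S := \sum_(i < n) p i * x i ^+ 2 + \sum_(i < n) p i * y i ^+ 2.
have SE : complex.Re l * S <= - delta * Q.
  rewrite /Q [- delta * _]mulrDr; apply: le_trans _ (lerD ex ey).
  rewrite /S -!big_split /= mulr_sumr le_eqVlt; apply/orP; left; apply/eqP.
  by apply: eq_bigr => i _; rewrite Ax Ay; ring.
have S0 : 0 <= S.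
  by rewrite addr_ge0// sumr_ge0// => i _; rewrite mulr_ge0 ?sqr_ge0// ltW.
have Q0 : 0 < Q.
  have [i vi0] : exists i, v 0 i != 0.
    by apply/existsP; apply: contraNT v0; rewrite negb_exists => /forallP h;
      apply/eqP/rowP => i; rewrite mxE; apply/eqP; move: (h i); rewrite negbK.
  rewrite /Q -big_split /= (bigD1 i)//= ltr_pwDl//; last first.
    by apply: sumr_ge0 => k _; rewrite addr_ge0// mulr_ge0 ?sqr_ge0// ltW.
  rewrite -mulrDr mulr_gt0// lt_neqAle addr_ge0 ?sqr_ge0// andbT eq_sym.
  rewrite paddr_eq0 ?sqr_ge0// !sqrf_eq0; apply: contra vi0.
  by rewrite /x /y; case: (v 0 i) => u w /= /andP[/eqP -> /eqP ->].
rewrite ltNge; apply/negP => l0.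
have : 0 <= - delta * Q by apply: le_trans _ SE; rewrite mulr_ge0.
by rewrite mulNr oppr_ge0 leNgt mulr_gt0.
Qed.

(** * Lyapunov equations *)

Section lyapunov.
Variables (R : realType) (n : nat) (B : 'M[R]_n) (kappa : R).
Implicit Types (Y Q : 'M[R]_n) (u v w : 'rV[R]_n).

Definition bilin Y u v : R := (u *m Y *m v^T) 0 0.

Lemma bilinE Y u v : bilin Y u v = \sum_i \sum_j u 0 i * Y i j * v 0 j.
Proof.
rewrite /bilin mxE exchange_big /=; apply: eq_bigr => j _.
by rewrite !mxE mulr_suml.
Qed.

Lemma bilinDl Y u v w : bilin Y (u + v) w = bilin Y u w + bilin Y v w.
Proof. by rewrite /bilin !mulmxDl mxE. Qed.

Lemma bilinDr Y u v w : bilin Y w (u + v) = bilin Y w u + bilin Y w v.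
Proof. by rewrite /bilin linearD mulmxDr mxE. Qed.

Lemma bilinZl Y k u v : bilin Y (k *: u) v = k * bilin Y u v.
Proof. by rewrite /bilin -!scalemxAl mxE. Qed.

Lemma bilinZr Y k u v : bilin Y u (k *: v) = k * bilin Y u v.
Proof. by rewrite /bilin linearZ -scalemxAr mxE. Qed.

Lemma bilinC Y u v : bilin Y u v = bilin Y^T v u.
Proof.
have -> : bilin Y u v = (u *m Y *m v^T)^T 0 0 by rewrite [in RHS]mxE.
by rewrite !trmx_mul trmxK mulmxA.
Qed.

Lemma bilin_delta Y i j : bilin Y (delta_mx 0 i) (delta_mx 0 j) = Y i j.
Proof. by rewrite /bilin -rowE trmx_delta -colE !mxE. Qed.

Lemma bilin0 Y : bilin Y 0 0 = 0.
Proof. by rewrite /bilin !mul0mx mxE. Qed.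

Lemma bilin1_ge0 v : 0 <= bilin 1%:M v v.
Proof.
rewrite /bilin mulmx1 mxE sumr_ge0// => i _; rewrite mxE -expr2; exact: sqr_ge0.
Qed.

Lemma bilin1_eq0 v : bilin 1%:M v v = 0 -> v = 0.
Proof.
rewrite /bilin mulmx1 mxE; under eq_bigr do rewrite mxE -expr2.
move/eqP; rewrite psumr_eq0; last by move=> i _; exact: sqr_ge0.
move=> /allP h; apply/rowP => i; rewrite mxE.
by have := h i (mem_index_enum _); rewrite sqrf_eq0 => /eqP.
Qed.

Definition possemidef Y := forall v, 0 <= bilin Y v v.

Hypotheses (kappa_gt0 : 0 < kappa)
  (dissB : forall v, bilin B v v <= - kappa * bilin 1%:M v v).

Let frob Y := \sum_i \sum_j Y i j ^+ 2.

(** Take the Frobenius product with [Y]: dissipativity applied to the columns bounds the part with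
    [B *m Y], applied to the rows the part with [Y *m B^T]. *)
Lemma lyapunov_inj Y : B *m Y + Y *m B^T = 0 -> Y = 0.
Proof.
move=> Y0.
have rowD i : \sum_j Y i j * (Y *m B^T) i j <= - kappa * \sum_j Y i j ^+ 2.
  have := dissB (row i Y); congr (_ <= _ * _).
    rewrite /bilin -mulmxA mxE; apply: eq_bigr => j _; rewrite !mxE; congr (_ * _).
    by apply: eq_bigr => k _; rewrite !mxE mulrC.
  by rewrite /bilin mulmx1 mxE; apply: eq_bigr => j _; rewrite !mxE expr2.
have colD j : \sum_i Y i j * (B *m Y) i j <= - kappa * \sum_i Y i j ^+ 2.
  have := dissB (col j Y)^T; congr (_ <= _ * _).
    rewrite /bilin -mulmxA mxE; apply: eq_bigr => i _; rewrite !mxE; congr (_ * _).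
    by apply: eq_bigr => k _; rewrite !mxE.
  by rewrite /bilin mulmx1 mxE; apply: eq_bigr => i _; rewrite !mxE expr2.
have le0 : 0 <= - kappa * frob Y + - kappa * frob Y.
  apply: (@le_trans _ _ (\sum_i \sum_j Y i j * (B *m Y + Y *m B^T) i j)).
    by rewrite Y0 sumr_ge0// => i _; rewrite sumr_ge0// => j _; rewrite mxE mulr0.
  under eq_bigr => i _ do (under eq_bigr => j _ do rewrite mxE mulrDr; rewrite big_split /=).
  rewrite big_split /= lerD//.
    rewrite exchange_big /= /frob [X in _ * X]exchange_big mulr_sumr.
    by apply: ler_sum => j _; exact: colD.
  by rewrite /frob mulr_sumr; apply: ler_sum => i _; exact: rowD.
have frob0 : frob Y = 0.
  apply/eqP; rewrite eq_le; apply/andP; split; last first.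
    by apply: sumr_ge0 => i _; apply: sumr_ge0 => j _; exact: sqr_ge0.
  by rewrite leNgt; apply/negP => F0; have := mulr_gt0 kappa_gt0 F0; lra.
apply/matrixP => i j; rewrite mxE.
move/eqP: frob0; rewrite psumr_eq0; last by move=> k _; apply: sumr_ge0 => l _; exact: sqr_ge0.
move=> /allP/(_ i (mem_index_enum _)) /=; rewrite psumr_eq0; last by move=> l _; exact: sqr_ge0.
by move=> /allP/(_ j (mem_index_enum _)) /=; rewrite sqrf_eq0 => /eqP.
Qed.

(** The Lyapunov operator is inverted as a matrix acting on vectorized matrices; injectivity is
    enough in finite dimension. *)
Definition lyapunov_sol Q :=
  vec_mx (mxvec (- Q) *m invmx (lin_mulmx B + lin_mulmxr B^T)).

Let lyapunov_mxE Y :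
  mxvec Y *m (lin_mulmx B + lin_mulmxr B^T) = mxvec (B *m Y + Y *m B^T).
Proof. by rewrite mulmxDr !mul_vec_lin /= linearD. Qed.

Lemma lyapunov_solP Q :
  B *m lyapunov_sol Q + lyapunov_sol Q *m B^T + Q = 0.
Proof.
have inv : lin_mulmx B + lin_mulmxr B^T \in unitmx.
  rewrite -row_free_unit; apply: inj_row_free => v.
  rewrite -[v]vec_mxK lyapunov_mxE => /(congr1 vec_mx); rewrite mxvecK linear0.
  by move/lyapunov_inj => ->; rewrite linear0.
apply/eqP; rewrite addr_eq0; apply/eqP; apply: (can_inj mxvecK).
by rewrite -lyapunov_mxE /lyapunov_sol vec_mxK mulmxKV.
Qed.

Lemma lyapunov_uniq Q Y : B *m Y + Y *m B^T + Q = 0 -> Y = lyapunov_sol Q.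
Proof.
move=> YQ; apply/eqP; rewrite -subr_eq0; apply/eqP/lyapunov_inj.
rewrite mulmxBr mulmxBl addrACA -opprD.
by rewrite -[X in X - _](addrK Q) YQ -[X in _ - X](addrK Q) lyapunov_solP subrr.
Qed.

Lemma lyapunov_sol_sym Q : Q^T = Q -> (lyapunov_sol Q)^T = lyapunov_sol Q.
Proof.
move=> QT; apply: lyapunov_uniq; have := congr1 trmx (lyapunov_solP Q).
by rewrite !linearD /= !trmx_mul trmxK QT linear0 [X in X + Q]addrC.
Qed.

(** Minimum of the Rayleigh quotient, attained because the unit sphere is a closed subset of the box
    with sides [-1, 1]. *)
Lemma bilin_min Y : ~ possemidef Y ->
  exists w m, [/\ m < 0, bilin 1%:M w w = 1, bilin Y w w = m &
    forall u, m * bilin 1%:M u u <= bilin Y u u].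
Proof.
move=> /existsNP[v /negP]; rewrite -ltNge => v0.
have bilin_cont Z : continuous (fun u => bilin Z u u).
  move=> u; under eq_fun do rewrite bilinE.
  apply: (@cvg_sumf _ _ _ (nbhs u) (nbhs_filter u)) => i.
  apply: (@cvg_sumf _ _ _ (nbhs u) (nbhs_filter u)) => j.
  apply: (@cvgM _ _ (nbhs u) (nbhs_filter u)); last exact: coord_continuous.
  apply: (@cvgM _ _ (nbhs u) (nbhs_filter u)); first exact: coord_continuous.
  exact: (@cvg_cst _ _ _ (nbhs u) (nbhs_filter u)).
pose S := [set u | bilin 1%:M u u = 1].
have normalize u : u != 0 -> S ((Num.sqrt (bilin 1%:M u u))^-1 *: u).
  move=> u0; have q0 : 0 < bilin 1%:M u u.
    rewrite lt_neqAle bilin1_ge0 andbT eq_sym; apply: contra u0 => /eqP.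
    by move/bilin1_eq0 => ->.
  rewrite /S /= bilinZl bilinZr mulrA -expr2 exprVn sqr_sqrtr ?ltW//.
  by rewrite mulVf// gt_eqF.
have vn0 : v != 0.
  by apply: contraTneq v0 => ->; rewrite bilin0 ltxx.
have Sc : compact S.
  have box := @rV_compact R n (fun=> `[(-1)%R, 1%R]%classic) (fun=> @segment_compact R _ _).
  apply: (subclosed_compact _ box).
  - rewrite (_ : S = (fun u => bilin 1%:M u u) @^-1` [set 1]) //.
    apply: closed_comp => [u _|]; [exact: bilin_cont|exact: closed_eq].
  - move=> u; rewrite /S /bilin /= mulmx1 mxE => u1 i /=.
    rewrite in_itv /= -ler_norml -(@ler_pXn2r _ 2)// ?nnegrE// expr1n real_normK ?num_real//.
    rewrite -u1 (bigD1 i)//= mxE -expr2 lerDl sumr_ge0// => j _.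
    by rewrite mxE -expr2 sqr_ge0.
have [w wS wmin] : exists2 w, w \in S & forall u, u \in S -> bilin Y w w <= bilin Y u u.
  apply: EVT_min_rV => //; first by exists ((Num.sqrt (bilin 1%:M v v))^-1 *: v); exact: normalize.
  by apply: continuous_subspaceT; exact: bilin_cont.
have minP u : bilin Y w w * bilin 1%:M u u <= bilin Y u u.
  have [->|u0] := eqVneq u 0; first by rewrite !bilin0 mulr0.
  have := wmin _ (mem_set (normalize u u0)); rewrite bilinZl bilinZr mulrA -expr2 exprVn.
  rewrite sqr_sqrtr ?bilin1_ge0// mulrC ler_pdivlMr//.
  rewrite lt_neqAle bilin1_ge0 andbT eq_sym; apply: contra u0 => /eqP.
  by move/bilin1_eq0 => ->.
exists w, (bilin Y w w); split => //; last by move/set_mem: wS.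
rewrite ltNge; apply/negP => w0; move: (minP v); rewrite leNgt (lt_le_trans v0)//.
by rewrite mulr_ge0// bilin1_ge0.
Qed.

(** At a unit minimizer [w] with negative minimum [m], the first-order condition replaces [Y] by [m]
    in the equation tested on [w]: 2 m B(w, w) + Q(w, w) = 0. But the first term is at least - 2 m
    kappa > 0. *)
Lemma lyapunov_possemidef Q Y : Y^T = Y -> possemidef Q ->
  B *m Y + Y *m B^T + Q = 0 -> possemidef Y.
Proof.
move=> YT Q0 YQ; apply: contrapT => /bilin_min[w [m [m0 w1 wm minY]]].
pose u := w *m B.
have wuE : bilin Y u w = m * bilin 1%:M u w.
  (* [t |-> q(w + t u)] is nonnegative and vanishes at 0, for [q = Y - m]. *)
  pose b := bilin Y u w - m * bilin 1%:M u w.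
  pose k := bilin Y u u - m * bilin 1%:M u u.
  have quad t : 0 <= t * (2 * b) + t ^+ 2 * k.
    have := minY (w + t *: u); rewrite !(bilinDl, bilinDr, bilinZl, bilinZr) wm w1.
    by rewrite (bilinC Y w u) (bilinC 1%:M w u) YT trmx1 /b /k; lra.
  have k0 : 0 <= k by rewrite subr_ge0.
  apply/eqP; rewrite -subr_eq0 -/b; apply/eqP.
  have := quad (- b / (k + 1)); have k1 : 0 < k + 1 by rewrite ltr_wpDl.
  have -> : - b / (k + 1) * (2 * b) + (- b / (k + 1)) ^+ 2 * k =
    - (b ^+ 2 * (k + 2) / (k + 1) ^+ 2) by field; rewrite gt_eqF.
  rewrite oppr_ge0 => le0.
  apply/eqP; rewrite -sqrf_eq0 eq_le sqr_ge0 andbT.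
  by move: le0; rewrite pmulr_lle0 ?invr_gt0 ?exprn_gt0// pmulr_lle0// ltr_wpDl.
have dw := dissB w; have Qw := Q0 w.
have : bilin (B *m Y + Y *m B^T + Q) w w = 0 by rewrite YQ /bilin mulmx0 mul0mx mxE.
have -> : bilin (B *m Y + Y *m B^T + Q) w w = bilin Y u w + bilin Y u w + bilin Q w w.
  rewrite {2}(bilinC Y u w) YT /bilin !mulmxDr !mulmxDl mxE [in LHS]mxE; congr (_ + _ + _).
    by rewrite /u !mulmxA.
  by rewrite /u trmx_mul !mulmxA.
rewrite wuE; have -> : bilin 1%:M u w = bilin B w w by rewrite /bilin mulmx1.
have h1 : m * (- kappa * 1) <= m * bilin B w w by rewrite ler_nM2l// -w1.
have h2 : m * kappa < 0 by rewrite nmulr_rlt0.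
lra.
Qed.

End lyapunov.

(** On t e_i + e_k the form is affine in [t], with slope [2 * Y i k]; for a nonzero slope the chosen
    [t] gives the value -1. *)
Lemma possemidef_diag_eq0 (R : realType) n (Y : 'M[R]_n) i k :
  Y^T = Y -> possemidef Y -> Y i i = 0 -> Y i k = 0.
Proof.
move=> YT Y0 Yi.
have YC a b : Y a b = Y b a by rewrite -[in LHS]YT mxE.
have quad t : 0 <= t * (2 * Y i k) + Y k k.
  have := Y0 (t *: delta_mx 0 i + delta_mx 0 k).
  rewrite !(bilinDl, bilinDr, bilinZl, bilinZr) !bilin_delta Yi (YC k i).
  by congr (_ <= _); ring.
have Yk : 0 <= Y k k by have := quad 0; rewrite mul0r add0r.
apply/eqP; case: eqP => // /eqP yn0.
have := quad (- (Y k k + 1) / (2 * Y i k)); rewrite divfK; last by rewrite mulf_neq0// pnatr_eq0.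
by rewrite opprD addrAC addNr add0r oppr_ge0 ler10.
Qed.

(** * Trace inequality for a normal matrix *)

Section trace_inequality.
Variables (R : realType) (n : nat) (B : 'M[R]_n) (kappa : R).
Hypotheses (kappa_gt0 : 0 < kappa)
  (dissB : forall v, bilin B v v <= - kappa * bilin 1%:M v v).
Hypothesis normalB : B *m B^T = B^T *m B.

Local Notation S := (lyapunov_sol B).

(** Stationary variance of coordinate [i] when unit white noise drives coordinate [j] alone. *)
Definition diag_response i j : R := S (delta_mx j j) i i.
Local Notation G := diag_response.

Lemma delta_mx_possemidef j : possemidef (delta_mx j j : 'M[R]_n).
Proof.
move=> v; rewrite bilinE (bigD1 j)//= (bigD1 j)//= big1 ?addr0.
  rewrite big1 ?addr0; first by rewrite mxE !eqxx mulr1 -expr2 sqr_ge0.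
  move=> i ij; rewrite big1// => k _.
  by rewrite mxE (negbTE ij) mulr0 mul0r.
by move=> k kj; rewrite mxE (negbTE kj) andbF mulr0 mul0r.
Qed.

Lemma response_sym j : (S (delta_mx j j))^T = S (delta_mx j j).
Proof. by apply: (lyapunov_sol_sym kappa_gt0 dissB); rewrite trmx_delta. Qed.

Lemma response_possemidef j : possemidef (S (delta_mx j j)).
Proof.
apply: (lyapunov_possemidef kappa_gt0 dissB (response_sym j) (@delta_mx_possemidef j)).
exact: lyapunov_solP kappa_gt0 dissB _.
Qed.

Lemma diag_response_ge0 i j : 0 <= G i j.
Proof. by rewrite /G -bilin_delta; exact: response_possemidef. Qed.

(** If [G i j] vanished, semidefiniteness would kill row [i] of the solution; the (i, j) entry of
    the equation would then give [Y j j = 0], hence row [j] zero, and the (j, j) entry would read 1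
    = 0. *)
Lemma diag_response_gt0 i j : i != j -> B i j != 0 ->
  (forall k, k != i -> k != j -> B i k = 0) -> 0 < G i j.
Proof.
move=> ij Bij Bi; rewrite lt_neqAle diag_response_ge0 andbT eq_sym; apply/eqP.
rewrite /G; set Y := S _ => Yii.
have YE := lyapunov_solP kappa_gt0 dissB (delta_mx j j); rewrite -/Y in YE.
have YT : Y^T = Y := response_sym j.
have Y0 : possemidef Y := @response_possemidef j.
clearbody Y.
have z0 a : Y a a = 0 -> forall k, Y a k = 0.
  by move=> Ya k; exact: possemidef_diag_eq0 YT Y0 Ya.
have YC a b : Y a b = Y b a by rewrite -[in LHS]YT mxE.
have Yjj : Y j j = 0.
  move/matrixP/(_ i j) : YE; rewrite !mxE (negbTE ij) addr0.
  rewrite [X in _ + X]big1 ?addr0; last by move=> k _; rewrite z0// mul0r.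
  rewrite (bigD1 i)//= z0// mulr0 add0r (bigD1 j)/=; last by rewrite eq_sym.
  rewrite big1 ?addr0; last by move=> k /andP[ki kj]; rewrite Bi// mul0r.
  by move/eqP; rewrite mulf_eq0 (negbTE Bij) => /eqP.
move/matrixP/(_ j j) : YE; rewrite !mxE !eqxx big1; last first.
  by move=> k _; rewrite YC z0// mulr0.
rewrite big1; last by move=> k _; rewrite z0// mul0r.
by rewrite !add0r => /eqP; rewrite oner_eq0.
Qed.

Let H := - (B + B^T).

Lemma symmetric_part_unit : H \in unitmx.
Proof.
rewrite -row_free_unit; apply: inj_row_free => v vH.
apply: bilin1_eq0; apply/eqP; rewrite eq_le bilin1_ge0 andbT.
have : bilin H v v = 0 by rewrite /bilin vH mul0mx mxE.
have -> : bilin H v v = - (bilin B v v + bilin B v v).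
  by rewrite {2}(bilinC B v v) /bilin /H mulmxN mulNmx mulmxDr mulmxDl !mxE.
have := dissB v; have := bilin1_ge0 v; set b := bilin B v v; set q := bilin 1%:M v v.
move=> q0 bq b0; rewrite leNgt; apply/negP => q1.
have := mulr_gt0 kappa_gt0 q1; lra.
Qed.

Let X0 := invmx H.

(** Normality makes [B] commute with its symmetric part, hence with the inverse; this is why [X0]
    solves the Lyapunov equation with identity right-hand side. *)
Let BX0 : B *m X0 = X0 *m B.
Proof.
have BH : B *m H = H *m B.
  by rewrite /H mulmxN mulNmx mulmxDr mulmxDl normalB.
rewrite /X0 -[RHS]mulmx1 -(mulmxV symmetric_part_unit) !mulmxA; congr (_ *m _).
by rewrite -mulmxA BH mulmxA mulVmx ?symmetric_part_unit// mul1mx.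
Qed.

Let X0E : B *m X0 + X0 *m B^T + 1%:M = 0.
Proof.
rewrite BX0 -mulmxDr -[B + _]opprK -/H mulmxN mulVmx ?symmetric_part_unit//.
by rewrite addNr.
Qed.

Lemma lyapunov_sol1 : S 1%:M = invmx H.
Proof. by apply/esym/(lyapunov_uniq kappa_gt0 dissB). Qed.

Lemma lyapunov_sol_diag (w : 'rV[R]_n) :
  S (diag_mx w) = \sum_j w 0 j *: S (delta_mx j j).
Proof.
apply/esym/(lyapunov_uniq kappa_gt0 dissB); rewrite diag_mx_sum_delta.
rewrite mulmx_sumr mulmx_suml -!big_split big1//= => j _.
rewrite -scalemxAr -scalemxAl -!scalerDr.
by rewrite (lyapunov_solP kappa_gt0 dissB) scaler0.
Qed.

Lemma diag_response_row i : \sum_j G i j = X0 i i.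
Proof.
rewrite /X0 -lyapunov_sol1 -diag_const_mx lyapunov_sol_diag summxE.
by apply: eq_bigr => j _; rewrite mxE [X in X * _]mxE mul1r.
Qed.

(** Duality: [X0] also solves the equation of B^T, so pairing the equation of [Y] with [X0] turns
    the trace of [Y] into the pairing of [X0] with the source [delta_mx j j]. *)
Lemma diag_response_col j : \sum_i G i j = X0 j j.
Proof.
rewrite -/(\tr (S (delta_mx j j))); set Y := S _.
have YE := lyapunov_solP kappa_gt0 dissB (delta_mx j j); rewrite -/Y in YE.
have X0T : X0^T = X0.
  by rewrite /X0 -lyapunov_sol1; apply: (lyapunov_sol_sym kappa_gt0 dissB); rewrite trmx1.
have X0E' : B^T *m X0 + X0 *m B = - 1%:M.
  rewrite -BX0 -mulmxDl addrC -[B + _]opprK -/H mulNmx mulmxV//.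
  exact: symmetric_part_unit.
have : \tr (X0 *m (B *m Y + Y *m B^T + delta_mx j j)) = 0.
  by rewrite YE mulmx0 mxtrace0.
rewrite !mulmxDr !mxtraceD !mulmxA [\tr (_ *m B^T)]mxtrace_mulC mulmxA -mxtraceD -mulmxDl.
rewrite addrC [X0 *m B + _]addrC X0E' mulNmx mul1mx linearN /=.
move=> /eqP; rewrite subr_eq0 => /eqP <-.
rewrite /mxtrace (bigD1 j)//= big1 ?addr0.
  by rewrite mxE (bigD1 j)//= big1 ?addr0 ?mxE ?eqxx ?mulr1// => k kj;
    rewrite mxE (negbTE kj) mulr0.
move=> k kj; rewrite mxE big1// => l _.
by rewrite mxE (negbTE kj) andbF mulr0.
Qed.

Variable d : 'I_n -> R.
Hypothesis d_gt0 : forall i, 0 < d i.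

Let gap i j : R := (d i / d j) ^+ 2 - 1 - 2 * (ln (d i) - ln (d j)).

Let gapE i j : gap i j = expR (2 * (ln (d i) - ln (d j))) - (1 + 2 * (ln (d i) - ln (d j))).
Proof.
rewrite /gap mulr_natl mulr2n expRD -expr2 expRD expRN !lnK ?posrE//.
by ring.
Qed.

Let gap_ge0 i j : 0 <= gap i j.
Proof. by rewrite gapE subr_ge0 expR_ge1Dx. Qed.

(* Row and column sums of [G] agree, so the linear terms of [exp t >= 1 + t] cancel. *)
Let trace_gap :
  \sum_i \sum_j (d i / d j) ^+ 2 * G i j = \tr X0 + \sum_i \sum_j G i j * gap i j.
Proof.
have -> : \tr X0 = \sum_i \sum_j G i j by apply: eq_bigr => i _; rewrite diag_response_row.
have bal : \sum_i \sum_j G i j * (2 * (ln (d i) - ln (d j))) = 0.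
  transitivity (\sum_i \sum_j G i j * (2 * ln (d i)) - \sum_i \sum_j G i j * (2 * ln (d j))).
    rewrite -sumrB; apply: eq_bigr => i _; rewrite -sumrB; apply: eq_bigr => j _.
    by ring.
  rewrite [X in _ - X]exchange_big /= -sumrB big1// => i _.
  by rewrite -!mulr_suml diag_response_row diag_response_col subrr.
rewrite -[LHS]addr0 -[X in _ + X]oppr0 -[in - 0]bal -sumrN -!big_split /=.
apply: eq_bigr => i _; rewrite -sumrN -!big_split /=; apply: eq_bigr => j _.
by rewrite /gap; ring.
Qed.

Let gap_sum_ge0 : 0 <= \sum_i \sum_j G i j * gap i j.
Proof.
apply: sumr_ge0 => i _; apply: sumr_ge0 => j _; rewrite mulr_ge0//.
exact: diag_response_ge0.
Qed.

Lemma trace_response_ge : \tr X0 <= \sum_i \sum_j (d i / d j) ^+ 2 * G i j.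
Proof. by rewrite trace_gap lerDl. Qed.

(** Equality forces every nonnegative product of [G] and [gap] to vanish, and e^t = 1 + t only at t
    = 0. *)
Lemma trace_response_eq i j : 0 < G i j ->
  \sum_i \sum_j (d i / d j) ^+ 2 * G i j = \tr X0 -> d i = d j.
Proof.
move=> Gij; rewrite trace_gap => /eqP; rewrite -subr_eq0 addrAC subrr add0r.
have Gg k l : 0 <= G k l * gap k l by rewrite mulr_ge0//; exact: diag_response_ge0.
rewrite psumr_eq0; last by move=> k _; apply: sumr_ge0.
move=> /allP/(_ i (mem_index_enum _)) /=; rewrite psumr_eq0//.
move=> /allP/(_ j (mem_index_enum _)) /=; rewrite mulf_eq0 gt_eqF//= gapE subr_eq0.
have [t0 _|/expR_gt1Dx] := eqVneq (2 * (ln (d i) - ln (d j))) 0; last by move/gt_eqF ->.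
move/eqP : t0; rewrite mulf_eq0 pnatr_eq0 /= subr_eq0 => /eqP.
by apply: ln_inj; rewrite posrE.
Qed.

End trace_inequality.

(** * Spectrum of normal and cyclic matrices *)

Lemma char_poly_conj (F : fieldType) n (P D : 'M[F]_n) : P \in unitmx ->
  char_poly (invmx P *m D *m P) = char_poly D.
Proof.
move=> Pu; rewrite /char_poly.
have -> : char_poly_mx (invmx P *m D *m P) =
    map_mx polyC (invmx P) *m char_poly_mx D *m map_mx polyC P.
  rewrite /char_poly_mx mulmxBr mulmxBl -!map_mxM; congr (_ - _).
  rewrite scalar_mxC -mulmxA -map_mxM mulVmx// map_mx1 mulmx1//.
rewrite !det_mulmx mulrC mulrA -det_mulmx -map_mxM mulmxV// map_mx1 det1.
by rewrite mul1r.
Qed.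

Lemma invmx_conj_diag (F : fieldType) n (P : 'M[F]_n) (t : 'rV[F]_n) :
  P \in unitmx -> (forall i, t 0 i != 0) ->
  invmx (invmx P *m diag_mx t *m P) =
  invmx P *m diag_mx (\row_i (t 0 i)^-1) *m P.
Proof.
move=> PU t0; set Q := invmx P *m diag_mx (\row_i (t 0 i)^-1) *m P.
have QQ : invmx P *m diag_mx t *m P *m Q = 1%:M.
  rewrite /Q !mulmxA mulmxK// -(mulmxA _ (diag_mx t)) mulmx_diag.
  rewrite (_ : diag_mx _ = 1%:M) ?mulmx1 ?mulVmx//.
  by apply/matrixP => i j; rewrite !mxE mulfV.
have [U _] := mulmx1_unit QQ.
by apply: (can_inj (mulKmx U)); rewrite mulmxV// QQ.
Qed.

Lemma char_poly_diag (R : comNzRingType) n (d : 'rV[R]_n) :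
  char_poly (diag_mx d) = \prod_(i < n) ('X - (d 0 i)%:P).
Proof.
rewrite char_poly_trig; last exact/diag_mx_is_trig.
by apply: eq_bigr => i _; rewrite mxE eqxx mulr1n.
Qed.

Section normal_matrix.
Variables (K : numClosedFieldType) (n : nat) (C : 'M[K]_n).
Hypothesis normalC : C \is normalmx.
Local Notation P := (spectralmx C).
Local Notation s := (spectral_diag C).

Let CE : C = invmx P *m diag_mx s *m P. Proof. exact/orthomx_spectralP. Qed.

Lemma char_poly_normal : char_poly C = \prod_(i < n) ('X - (s 0 i)%:P).
Proof. by rewrite CE char_poly_conj ?spectral_unit// char_poly_diag -CE. Qed.

Lemma mxtrace_inv_normal : (forall i, s 0 i + (s 0 i)^* != 0) ->
  \tr (invmx (- (C + C^t*%sesqui))) = - \sum_i (s 0 i + (s 0 i)^*)^-1.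
Proof.
move=> s_neq0; have Pu : P \is unitarymx := spectral_unitarymx C.
have HE : - (C + C^t*%sesqui) =
    invmx P *m diag_mx (\row_i (- (s 0 i + (s 0 i)^*))) *m P.
  have -> : C^t*%sesqui = invmx P *m diag_mx (map_mx Num.conj s) *m P.
    rewrite [in LHS]CE !trmx_mul !map_mxM /= invmx_unitary// trmxCK mulmxA.
    by rewrite tr_diag_mx map_diag_mx.
  rewrite [X in - (X + _)]CE -mulmxDl -mulmxDr -mulNmx -mulmxN -linearD -linearN.
  by congr (_ *m diag_mx _ *m _); apply/rowP => i; rewrite !mxE.
rewrite HE invmx_conj_diag ?spectral_unit//; last first.
  by move=> i; rewrite mxE oppr_eq0.
rewrite mxtrace_mulC mulmxA mulmxV ?spectral_unit// mul1mx mxtrace_diag -sumrN.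
by apply: eq_bigr => i _; rewrite !mxE invrN.
Qed.

End normal_matrix.

Lemma eigenvalues_char_poly (R : realType) n (A : 'M[R]_n) :
  char_poly (complex_mx A) = \prod_(z <- eigenvalues A) ('X - z%:P).
Proof.
rewrite /eigenvalues; case: closed_field_poly_normal => s /= sE.
by rewrite [LHS]sE (monicP (char_poly_monic _)) scale1r.
Qed.

Lemma eigenvalue_mem (R : realType) n (A : 'M[R]_n) l :
  (l \in eigenvalues A) = eigenvalue (complex_mx A) l.
Proof. by rewrite eigenvalue_root_char eigenvalues_char_poly root_prod_XsubC. Qed.

Lemma normal_trace_symmetric_part (R : realType) n (B : 'M[R]_n) :
  B *m B^T = B^T *m B -> hurwitz B ->
  \tr (invmx (- (B + B^T))) =
  - \sum_(l <- eigenvalues B) (2 * complex.Re l)^-1.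
Proof.
move=> normalB hB; set C := complex_mx B.
have CT : C^t*%sesqui = complex_mx B^T.
  by apply/matrixP => i j; rewrite !mxE; exact: conjc_real.
have Cn : C \is normalmx.
  apply/normalmxP; rewrite CT /C /complex_mx -!map_mxM; congr map_mx.
  exact: normalB.
pose s := spectral_diag C.
(* [eigenvalues B] comes in an unspecified order; unique factorization identifies it with the
   spectral diagonal up to permutation. *)
have /prod_XsubC_eq perm_s : \prod_(z <- eigenvalues B) ('X - z%:P) =
    \prod_(z <- [seq s 0 i | i <- index_enum 'I_n]) ('X - z%:P).
  by rewrite -eigenvalues_char_poly -/C char_poly_normal// big_map.
have re_lt0 i : complex.Re (s 0 i) < 0.
  apply: hB; rewrite -eigenvalue_mem (perm_mem perm_s).
  by apply/mapP; exists i => //; exact: mem_index_enum.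
have reE (z : complex R) : z + Num.conj z = ((2 * complex.Re z)%:C)%C.
  rewrite -[Num.conj z]/(conjc z); case: z => x y.
  by apply/eqP; rewrite eq_complex /=; apply/andP; split; apply/eqP; ring.
have s_neq0 i : s 0 i + Num.conj (s 0 i) != 0.
  by rewrite reE fmorph_eq0 mulf_neq0 ?pnatr_eq0// lt_eqF.
have trE := mxtrace_inv_normal Cn s_neq0.
apply: (fmorph_inj (real_complex R)); rewrite -trace_map_mx map_invmx.
have -> : map_mx (real_complex R) (- (B + B^T)) = - (C + C^t*%sesqui).
  by rewrite CT /C /complex_mx map_mxN map_mxD.
rewrite trE (perm_big _ perm_s) /= big_map rmorphN rmorph_sum; congr (- _).
by apply: eq_bigr => i _; rewrite reE fmorphV.
Qed.

(** * Logarithmic derivatives of a split polynomial *)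

Section logarithmic_derivative.
Variable F : fieldType.
Implicit Types (s : seq F) (x : F).

Lemma deriv_prod_XsubC s x : x \notin s ->
  (\prod_(z <- s) ('X - z%:P))^`().[x] =
  (\prod_(z <- s) ('X - z%:P)).[x] * \sum_(z <- s) (x - z)^-1.
Proof.
elim: s => [|z s ih]; first by rewrite !big_nil derivC hornerC mulr0.
rewrite in_cons negb_or => /andP[xz /ih {}ih].
rewrite !big_cons derivM derivXsubC mul1r hornerD !hornerM ih !hornerXsubC.
by field; rewrite subr_eq0.
Qed.

(** The second order is needed for gamma = 1, where the two evaluation points v and w coincide. *)
Lemma deriv2_prod_XsubC s x : x \notin s ->
  (\prod_(z <- s) ('X - z%:P))^`()^`().[x] =
  (\prod_(z <- s) ('X - z%:P)).[x] *
  ((\sum_(z <- s) (x - z)^-1) ^+ 2 - \sum_(z <- s) (x - z) ^- 2).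
Proof.
elim: s => [|z s ih].
  by rewrite !big_nil derivC deriv0 horner0 expr0n subr0 mulr0.
rewrite in_cons negb_or => /andP[xz xs]; move: (ih xs) (deriv_prod_XsubC xs) => {}ih ih1.
rewrite !big_cons derivM derivXsubC mul1r derivD derivM derivXsubC mul1r.
rewrite !hornerD !hornerM ih ih1 !hornerXsubC.
by field; rewrite subr_eq0.
Qed.

End logarithmic_derivative.

(** * Characteristic polynomial and spectral sum of the cyclic matrix *)

Section cyclic_spectrum.
Variables (R : realType) (m : nat) (a0 : R) (c : 'I_m.+2 -> R).
Hypothesis c_gt0 : forall i, 0 < c i.
Local Notation n := m.+2.
Local Notation A := (cyclic_mx (fun=> a0) c).
Local Notation al := (a0%:C)%C.
Local Notation g := ((geometric_mean c)%:C)%C.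

Let g_gt0 : 0 < geometric_mean c.
Proof. by apply/powR_gt0/prodr_gt0. Qed.

Let prodcE : g ^+ n = ((\prod_(i < n) c i)%:C)%C.
Proof. by rewrite -rmorphXn /= geometric_meanX. Qed.

Let g_neq0 : g != 0 :> complex R.
Proof. by rewrite fmorph_eq0 gt_eqF. Qed.

(** The rows other than the first determine the eigenvector by [e k.+1 * mu = cn k * e k]; the first
    row then closes the cycle precisely when mu^n is minus the product of the couplings. *)
Lemma eigenvalue_cyclic l : (l + al) ^+ n = - g ^+ n -> eigenvalue (complex_mx A) l.
Proof.
move=> lE; rewrite eigenvalue_root_char -char_poly_tr -eigenvalue_root_char.
pose mu := l + al.
have mu0 : mu != 0.
  apply: contraTneq isT => mu0; move/eqP: lE; rewrite -/mu mu0 expr0n eq_sym oppr_eq0 expf_eq0 /=.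
  by rewrite (negbTE g_neq0).
pose cn k : complex R := ((c (inord k))%:C)%C.
pose e k := \prod_(j < k) (cn j / mu).
have eS k : e k.+1 * mu = cn k * e k.
  by rewrite /e big_ord_recr /= -mulrA divfK// mulrC.
have eE k : e k * mu ^+ k = \prod_(j < k) cn j.
  elim: k => [|k ih]; first by rewrite /e !big_ord0 mulr1.
  by rewrite big_ord_recr /= -ih exprS mulrA eS; ring.
apply/eigenvalueP; exists (\row_i e i); last first.
  apply/eqP => /rowP/(_ ord0); rewrite !mxE /e big_ord0 => /eqP.
  by rewrite oner_eq0.
apply/rowP => i; rewrite mxE [RHS]mxE [X in _ = _ * X]mxE.
have -> : \sum_k (\row_i0 e i0) 0 k * (complex_mx A)^T k i =
    \sum_k real_complex R (A i k) * e k.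
  apply: eq_bigr => k _; rewrite [X in X * _]mxE mulrC; congr (_ * _).
  by rewrite mxE [LHS]mxE.
rewrite (cyclic_mx_row (real_complex R)) /=.
have -> : l = mu - al by rewrite /mu addrK.
rewrite mulrBl addrC -mulNr; congr (_ + _).
case: ifPn => [/eqP i0|i0].
  rewrite i0 {2}/e big_ord0 mulr1; apply: (mulIf (expf_neq0 m.+1 mu0)).
  rewrite -mulrA eE -exprS lE mulNr; congr (- _).
  rewrite prodcE rmorph_prod [in RHS]big_ord_recr /= mulrC; congr (_ * _).
    by apply: eq_bigr => j _; congr (c _)%:C%C; apply: val_inj; rewrite /= inordK// ltnW// ltnS.
rewrite -[in RHS](prednK (_ : 0 < i)%N) ?lt0n// [RHS]mulrC eS inordK//.
by rewrite (leq_ltn_trans (leq_pred _)).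
Qed.

(** No determinant is expanded: the right-hand side is monic of degree [n], its roots are
    eigenvalues, and they are pairwise distinct, so they exhaust the characteristic polynomial. *)
Lemma char_poly_cyclic :
  char_poly (complex_mx A) = ('X + al%:P) ^+ n + (g ^+ n)%:P.
Proof.
pose q : {poly complex R} := ('X + al%:P) ^+ n + (g ^+ n)%:P.
have Xmon : ('X + al%:P) ^+ n \is monic by rewrite monic_exp// monicXaddC.
have sX : size (('X + al%:P) ^+ n) = n.+1.
  by rewrite -[al]opprK polyCN size_exp_XsubC.
have sC : (size (g ^+ n)%:P < size (('X + al%:P) ^+ n)%R)%N.
  by rewrite sX (leq_ltn_trans (size_polyC_leq1 _)).
have sq : size q = n.+1 by rewrite /q size_polyDl// sX.
have qmon : q \is monic by rewrite monicE /q lead_coefDl// -monicE.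
have [r qE] := closed_field_poly_normal q.
rewrite (monicP qmon) scale1r in qE.
have sr : size r = n by have := size_prod_XsubC r id; rewrite -qE sq => -[].
have ur : uniq r.
  rewrite -separable_prod_XsubC -qE separable_poly.unlock.
  (* Euler's relation: q - (X + al) q' / n is the nonzero constant [g ^+ n]. *)
  apply/Bezout_coprimepP; exists (1, - (n%:R^-1 *: ('X + al%:P))) => /=.
  have -> : 1 * q + - (n%:R^-1 *: ('X + al%:P)) * q^`() = (g ^+ n)%:P.
    rewrite mul1r /q derivD derivC addr0 deriv_exp derivD derivX derivC addr0 /=.
    rewrite mul1r mulNr -scalerAl mulrnAr -exprS -[_ ^+ n *+ n]scaler_nat.
    rewrite scalerA mulVf ?pnatr_eq0//.
    by rewrite scale1r addrAC subrr add0r.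
  by rewrite polyC_eqp1 expf_neq0.
have rootr : all (root (char_poly (complex_mx A))) r.
  apply/allP => l lr; rewrite -eigenvalue_root_char; apply: eigenvalue_cyclic.
  have : root q l by rewrite qE root_prod_XsubC.
  by rewrite /root /q !hornerE addr_eq0 => /eqP.
rewrite (all_roots_prod_XsubC _ rootr).
- by rewrite (monicP (char_poly_monic _)) scale1r -qE.
- by rewrite size_char_poly sr.
- by rewrite uniq_rootsE.
Qed.

End cyclic_spectrum.

Section cyclic_eigenvalue_sum.
Variables (R : realType) (m : nat) (a0 : R) (c : 'I_m.+2 -> R).
Hypothesis c_gt0 : forall i, 0 < c i.
Local Notation n := m.+2.
Local Notation A := (cyclic_mx (fun=> a0) c).
Local Notation al := (a0%:C)%C.
Local Notation gc := (geometric_mean c).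
Local Notation g := (gc%:C)%C.
Local Notation s := (eigenvalues A).
Hypothesis hurwitzA : hurwitz A.

Let gc_gt0 : 0 < gc. Proof. exact: geometric_mean_gt0. Qed.

Let g_neq0 : g != 0 :> complex R.
Proof. by rewrite fmorph_eq0 gt_eqF. Qed.

Let prodE : \prod_(z <- s) ('X - z%:P) = ('X + al%:P) ^+ n + (g ^+ n)%:P.
Proof. by rewrite -eigenvalues_char_poly char_poly_cyclic. Qed.

Let prod_at x : (\prod_(z <- s) ('X - z%:P)).[x] = (x + al) ^+ n + g ^+ n.
Proof. by rewrite prodE !hornerE. Qed.

Let sE l : (l \in s) = ((l + al) ^+ n + g ^+ n == 0).
Proof. by rewrite -root_prod_XsubC /root prod_at. Qed.

Let re_lt0 l : l \in s -> complex.Re l < 0.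
Proof. by rewrite eigenvalue_mem => /hurwitzA. Qed.

Let mu_neq0 l : l \in s -> l + al != 0.
Proof.
rewrite sE; apply: contraTneq => ->.
by rewrite expr0n add0r expf_eq0 negb_and g_neq0 orbT.
Qed.

Let mu_normE l : l \in s -> (l + al) * conjc (l + al) = g ^+ 2.
Proof.
rewrite sE addr_eq0 => /eqP lE.
have : `|l + al| ^+ n = g ^+ n.
  by rewrite -normrX lE normrN normrX ger0_norm// lecE /= eqxx ltW.
move/(pexpIrn (ltn0Sn m.+1)) => nE.
by rewrite -[LHS]normCK nE// nnegrE// lecE /= eqxx ltW.
Qed.

(** All mu = l + al have modulus [g], so the conjugate of mu is g^2 / mu, and 2 Re l = mu + g^2 / mu
    - 2 al becomes quadratic after multiplication by mu. *)
Let re_factor l v w : l \in s -> v + w = 2 * al -> v * w = g ^+ 2 ->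
  ((2 * complex.Re l)%:C)%C * (l + al) = (l + al - v) * (l + al - w).
Proof.
move=> ls vw vw'.
have -> : ((2 * complex.Re l)%:C)%C = l + al + conjc (l + al) - (v + w).
  have -> : conjc (l + al) = conjc l + al.
    by case: (l) => x y; apply/eqP; rewrite eq_complex /=; apply/andP; split; apply/eqP; ring.
  by rewrite vw rmorphM rmorph_nat -addcJ; ring.
rewrite [RHS](_ : _ = (l + al) ^+ 2 + v * w - (v + w) * (l + al)); last by ring.
by rewrite vw' -(mu_normE ls); ring.
Qed.

Let muB_neq0 l v w : l \in s -> v + w = 2 * al -> v * w = g ^+ 2 -> v != l + al.
Proof.
move=> ls vw vw'; have := re_factor ls vw vw'; apply: contra_eq_neq => ->.
rewrite subrr mul0r mulf_neq0// ?mu_neq0//.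
by rewrite fmorph_eq0 mulf_neq0 ?pnatr_eq0// lt_eqF// re_lt0.
Qed.

Let inv_re l v w : l \in s -> v + w = 2 * al -> v * w = g ^+ 2 ->
  (((2 * complex.Re l)^-1)%:C)%C = (l + al) / ((v - (l + al)) * (w - (l + al))).
Proof.
move=> ls vw vw'; have h := re_factor ls vw vw'.
have v0 := muB_neq0 ls vw vw'.
have w0 : w != l + al by apply: (muB_neq0 ls (etrans (addrC _ _) vw) (etrans (mulrC _ _) vw')).
have -> : (v - (l + al)) * (w - (l + al)) = (l + al - v) * (l + al - w) by ring.
have x0 : ((2 * complex.Re l)%:C)%C != 0 :> complex R.
  by rewrite fmorph_eq0 mulf_neq0 ?pnatr_eq0// lt_eqF// re_lt0.
rewrite -h fmorphV; move: x0; set x := (_%:C)%C => x0; have y0 := mu_neq0 ls.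
by rewrite invfM mulrCA mulfV ?mulr1.
Qed.

Let derivXaddX k :
  (('X + al%:P) ^+ k.+1)^`() = ('X + al%:P) ^+ k *+ k.+1 :> {poly complex R}.
Proof. by rewrite deriv_exp derivD derivX derivC addr0 mul1r. Qed.

Let root_neq v w : v + w = 2 * al -> v * w = g ^+ 2 -> v - al \notin s.
Proof.
move=> vw vw'; apply/negP => vs; have := muB_neq0 vs vw vw'.
by rewrite subrK eqxx.
Qed.

Let log_deriv v : v - al \notin s ->
  \sum_(l <- s) (v - (l + al))^-1 = n%:R * v ^+ m.+1 / (v ^+ n + g ^+ n).
Proof.
move=> vs; have := deriv_prod_XsubC vs.
have := vs; rewrite sE subrK => D0.
rewrite prod_at subrK prodE derivD derivC addr0 derivXaddX.
rewrite hornerMn !hornerE subrK => h.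
transitivity (\sum_(l <- s) (v - al - l)^-1).
  by apply: eq_bigr => l _; rewrite opprD addrA addrAC.
apply: (mulfI D0); rewrite -h -mulr_natl mulrCA mulfV// mulr1.
done.
Qed.

Lemma eigenvalue_sum v w : v + w = 2 * al -> v * w = g ^+ 2 -> v != w ->
  ((- \sum_(l <- s) (2 * complex.Re l)^-1)%:C)%C =
  n%:R / (v - w) * ((v ^+ n - g ^+ n) / (v ^+ n + g ^+ n)).
Proof.
move=> vw vw' vneqw; have vws : w + v = 2 * al by rewrite addrC.
have vws' : w * v = g ^+ 2 by rewrite mulrC.
have vs := root_neq vw vw'; have ws := root_neq vws vws'.
have vw0 : v - w != 0 by rewrite subr_eq0.
rewrite rmorphN rmorph_sum /=.
(* Partial fractions in mu = l + al, which leave two logarithmic derivatives, at v and at w. *)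
transitivity (\sum_(l <- s) (v - w)^-1 * (v * (v - (l + al))^-1 - w * (w - (l + al))^-1)).
  rewrite -sumrN big_seq [RHS]big_seq; apply: eq_bigr => l ls.
  rewrite (inv_re ls vw vw').
  have v1 : v - (l + al) != 0 by rewrite subr_eq0; exact: muB_neq0 vw vw'.
  have w1 : w - (l + al) != 0 by rewrite subr_eq0; exact: muB_neq0 vws vws'.
  by field; rewrite vw0 v1 w1.
rewrite -mulr_sumr sumrB -!mulr_sumr !log_deriv//.
have /negbTE := vs; rewrite sE subrK => /negbT.
have /negbTE := ws; rewrite sE subrK => /negbT.
have : v ^+ n * w ^+ n = (g ^+ n) ^+ 2 by rewrite -exprMn vw' -!exprM mulnC.
have vE : v * v ^+ m.+1 = v ^+ n by rewrite -exprS.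
have wE : w * w ^+ m.+1 = w ^+ n by rewrite -exprS.
rewrite (_ : v * _ = n%:R * (v * v ^+ m.+1) / (v ^+ n + g ^+ n));
  last by rewrite !mulrA [v * _]mulrC.
rewrite (_ : w * _ = n%:R * (w * w ^+ m.+1) / (w ^+ n + g ^+ n));
  last by rewrite !mulrA [w * _]mulrC.
rewrite vE wE; set V := v ^+ n; set W := w ^+ n; set G := g ^+ n => VW W0 V0.
transitivity (n%:R / (v - w) * ((V * G - W * G) / ((V + G) * (W + G)))).
  by field; rewrite vw0 V0 W0.
congr (_ * _).
(* The relation V W = G^2 eliminates [W] from the result. *)
have -> : V * G - W * G = (V - G) * (W + G).
  rewrite [RHS](_ : _ = V * W + V * G - W * G - G ^+ 2); last by ring.
  by rewrite VW; ring.
by field; rewrite V0 W0.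
Qed.

Lemma eigenvalue_sum_double : a0 = gc ->
  - \sum_(l <- s) (2 * complex.Re l)^-1 = n%:R ^+ 2 / (4 * gc).
Proof.
move=> a0E; apply: (fmorph_inj (real_complex R)).
have vw : g + g = 2 * al by rewrite a0E mulr2n mulrDl mul1r.
have vw' : g * g = g ^+ 2 by rewrite expr2.
have gs := root_neq vw vw'.
rewrite rmorphN rmorph_sum /=.
(* Partial fractions at the double point v = w = g. *)
transitivity (\sum_(l <- s) ((g - (l + al))^-1 - g * (g - (l + al)) ^- 2)).
  rewrite -sumrN big_seq [RHS]big_seq; apply: eq_bigr => l ls.
  rewrite (inv_re ls vw vw').
  have g1 : g - (l + al) != 0 by rewrite subr_eq0; exact: muB_neq0 vw vw'.
  by field.
rewrite sumrB -mulr_sumr log_deriv//.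
have := deriv2_prod_XsubC gs.
have lE : \sum_(l <- s) (g - al - l)^-1 = n%:R * g ^+ m.+1 / (g ^+ n + g ^+ n).
  rewrite -log_deriv//; apply: eq_bigr => l _; by rewrite opprD addrA addrAC.
have l2E : \sum_(l <- s) (g - al - l) ^- 2 = \sum_(l <- s) (g - (l + al)) ^- 2.
  by apply: eq_bigr => l _; rewrite opprD addrA addrAC.
rewrite lE l2E prod_at subrK prodE derivD derivC addr0 derivXaddX.
rewrite derivMn derivXaddX !hornerMn !hornerE subrK.
set T := \sum_(l <- s) _ => h.
have gm0 : g ^+ m != 0 by rewrite expf_neq0.
have n0 : n%:R != 0 :> complex R by rewrite pnatr_eq0.
have TE : T = (n%:R * g ^+ m.+1 / (g ^+ n + g ^+ n)) ^+ 2 -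
    (g ^+ m *+ m.+1 *+ n) / (g ^+ n + g ^+ n).
  move: h; have : g ^+ n + g ^+ n != 0.
    by rewrite -mulr2n -mulr_natl mulf_neq0 ?pnatr_eq0// expf_neq0.
  set D := g ^+ n + g ^+ n; set X := (_ / D) ^+ 2; set Y := _ *+ n => D0 h.
  by rewrite h mulrAC mulfV// mul1r subKr.
have -> : ((n%:R ^+ 2 / (4 * gc))%:C)%C = n%:R ^+ 2 / (4 * g) :> complex R.
  by rewrite fmorph_div rmorphXn rmorphM !rmorph_nat.
rewrite TE.
rewrite -[g ^+ m *+ m.+1]mulr_natr -[_ * _ *+ n]mulr_natr.
rewrite [g ^+ n]exprS [g ^+ m.+1]exprS; move: gm0; set G := g ^+ m => G0.
rewrite -[n%:R]natr1; set N : complex R := m.+1%:R.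
field; apply/andP; split; first exact: g_neq0.
by rewrite -mulr2n -mulr_natl mulf_neq0 ?pnatr_eq0// mulf_neq0// mulf_neq0.
Qed.

End cyclic_eigenvalue_sum.

Lemma de_moivre (R : realType) (x : R) k :
  (Complex (cos x) (sin x)) ^+ k = Complex (cos (k%:R * x)) (sin (k%:R * x)).
Proof.
elim: k => [|k ih]; first by rewrite expr0 mul0r cos0 sin0.
rewrite exprS ih -natr1 mulrDl mul1r cosD sinD.
by apply/eqP; rewrite eq_complex /=; apply/andP; split; apply/eqP; ring.
Qed.

(** * Closed form of the spectral sum *)

Section cyclic_bound.
Variables (R : realType) (m : nat) (a0 : R) (c : 'I_m.+2 -> R).
Hypotheses (a0_gt0 : 0 < a0) (c_gt0 : forall i, 0 < c i).
Local Notation n := m.+2.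
Local Notation A := (cyclic_mx (fun=> a0) c).
Local Notation gc := (geometric_mean c).
Local Notation g := (gc%:C)%C.
Local Notation gamma := (a0 / gc).
Hypothesis hurwitzA : hurwitz A.
Hypothesis gammaP : cos (pi / n%:R) < gamma.

Let gc_gt0 : 0 < gc. Proof. exact: geometric_mean_gt0. Qed.

Let a0E : a0 = gc * gamma.
Proof. by rewrite mulrC divfK// gt_eqF. Qed.

Let gamma_gt0 : 0 < gamma. Proof. by rewrite divr_gt0. Qed.

Let n0 : n%:R != 0 :> R. Proof. by rewrite pnatr_eq0. Qed.

Lemma cyclic_bound_lt1 : gamma < 1 ->
  - \sum_(l <- eigenvalues A) (2 * complex.Re l)^-1 = cyclic_bound n gc gamma.
Proof.
move=> gamma1; pose ph := acos gamma.
have gi : -1 <= gamma <= 1 by rewrite (ltW gamma1) andbT (le_trans _ (ltW gamma_gt0)).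
have cph : cos ph = gamma by exact: acosK.
have ph0 : 0 < ph by apply: acos_gt0; rewrite gamma1 andbT; case/andP: gi.
(* The condition on gamma puts half of beta below pi / 2; hence [cos b > 0] and the tangent is
   finite. *)
have pin : ph < pi / n%:R.
  have pn0 : 0 <= pi / n%:R :> R by rewrite divr_ge0 ?pi_ge0.
  have pnpi : pi / n%:R <= pi :> R.
    by rewrite ler_pdivrMr ?ltr0n// ler_peMr ?pi_ge0// ler1n.
  by rewrite -ltr_cos ?cph// in_itv/= ?pn0 ?pnpi// acos_ge0// acos_lepi.
have php : ph < pi.
  by apply: lt_le_trans pin _; rewrite ler_pdivrMr ?ltr0n// ler_peMr ?pi_ge0// ler1n.
have sph : 0 < sin ph by apply: sin_gt0_pi; rewrite ph0.
pose b := n%:R * ph / 2.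
have cb : 0 < cos b.
  apply: cos_gt0_pihalf; apply/andP; split.
    by rewrite (lt_trans _ (_ : 0 < b))// ?oppr_lt0 ?divr_gt0 ?pi_gt0// mulr_gt0// ltr0n.
  by rewrite ltr_pM2r ?invr_gt0// mulrC -ltr_pdivlMr// ltr0n.
rewrite /cyclic_bound gamma1 /cyclic_beta (ltW gamma1) -/ph.
rewrite [n%:R * ph / n%:R]mulrAC mulfV// mul1r -/b.
apply: (fmorph_inj (real_complex R)) => /=.
(* Since a0 = g cos ph, these are the roots of x^2 - 2 a0 x + g^2. With the half-angle factor e =
   exp(i b), v^n - g^n and v^n + g^n are g^n e times 2 i sin b and 2 cos b. *)
pose v := g * Complex (cos ph) (sin ph); pose w := g * Complex (cos ph) (- sin ph).
pose e := Complex (cos b) (sin b); pose eb := Complex (cos b) (- sin b).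
have ee : e * eb = 1.
  apply/eqP; rewrite eq_complex /=; apply/andP; split; apply/eqP; last by ring.
  by rewrite -(cos2Dsin2 b); ring.
pose I : complex R := Complex 0 1.
have I2 : I * I = -1 by apply/eqP; rewrite eq_complex /=; apply/andP; split; apply/eqP; ring.
have I0 : I != 0.
  by apply/eqP => I0; move: I2; rewrite I0 mul0r => /eqP;
    rewrite eq_sym oppr_eq0 oner_eq0.
have e0 : e != 0 by apply/eqP => e0; move: ee; rewrite e0 mul0r => /eqP; rewrite eq_sym oner_eq0.
have cC0 : ((cos b)%:C)%C != 0 :> complex R by rewrite fmorph_eq0 gt_eqF.
have sC0 : ((sin ph)%:C)%C != 0 :> complex R by rewrite fmorph_eq0 gt_eqF.
have gC0 : g != 0 :> complex R by rewrite fmorph_eq0 gt_eqF.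
have vw : v + w = 2 * (a0%:C)%C.
  rewrite -mulrDr a0E rmorphM /= -cph mulrCA; congr (_ * _).
  by apply/eqP; rewrite eq_complex /=; apply/andP; split; apply/eqP; ring.
have vw' : v * w = g ^+ 2.
  rewrite mulrACA -expr2; rewrite [X in _ * X](_ : _ = 1) ?mulr1//.
  apply/eqP; rewrite eq_complex /=; apply/andP; split; apply/eqP; last by ring.
  by rewrite -(cos2Dsin2 ph); ring.
have vBw : v - w = 2 * g * ((sin ph)%:C)%C * I.
  rewrite -mulrBr [2 * g]mulrC -!mulrA; congr (_ * _).
  by apply/eqP; rewrite eq_complex /=; apply/andP; split; apply/eqP; ring.
have vneqw : v != w.
  by rewrite -subr_eq0 vBw !mulf_neq0// pnatr_eq0.
rewrite (eigenvalue_sum c_gt0 hurwitzA vw vw' vneqw).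
have vn : v ^+ n = g ^+ n * e ^+ 2.
  rewrite exprMn de_moivre de_moivre; congr (_ * Complex (cos _) (sin _)).
    by rewrite /b mulrCA mulfV ?mulr1// pnatr_eq0.
  by rewrite /b mulrCA mulfV ?mulr1// pnatr_eq0.
have q1 : v ^+ n - g ^+ n = g ^+ n * e * (2 * I * ((sin b)%:C)%C).
  rewrite vn [X in _ - X](_ : _ = g ^+ n * (e * eb)); last by rewrite ee mulr1.
  rewrite expr2 -mulrBr -mulrBr mulrA; congr (_ * _).
  by apply/eqP; rewrite eq_complex /=; apply/andP; split; apply/eqP; ring.
have q2 : v ^+ n + g ^+ n = g ^+ n * e * (2 * ((cos b)%:C)%C).
  rewrite vn [X in _ + X](_ : _ = g ^+ n * (e * eb)); last by rewrite ee mulr1.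
  rewrite expr2 -mulrDr -mulrDr mulrA; congr (_ * _).
  by apply/eqP; rewrite eq_complex /=; apply/andP; split; apply/eqP; ring.
rewrite q1 q2 vBw /tan.
have -> : ((n%:R * (sin b / cos b) / (2 * gc * sin ph))%:C)%C =
    n%:R * (((sin b)%:C)%C / ((cos b)%:C)%C) / (2 * g * ((sin ph)%:C)%C) :> complex R.
  by rewrite fmorph_div rmorphM rmorph_nat fmorph_div !rmorphM rmorph_nat.
have gn0 : g ^+ n != 0 by rewrite expf_neq0.
move: gn0 e0 cC0 sC0 gC0 I0; clear.
move: (g ^+ n) e ((cos b)%:C)%C ((sin ph)%:C)%C g I ((sin b)%:C)%C => G e C S g I T.
move=> G0 e0 C0 S0 g0 I0; field.
by rewrite G0 e0 C0 S0 g0 I0.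
Qed.

Lemma cyclic_bound_gt1 : 1 < gamma ->
  - \sum_(l <- eigenvalues A) (2 * complex.Re l)^-1 = cyclic_bound n gc gamma.
Proof.
move=> gamma1; pose q := Num.sqrt (gamma ^+ 2 - 1); pose ph := arcosh gamma.
have q2 : q ^+ 2 = gamma ^+ 2 - 1.
  by rewrite sqr_sqrtr// subr_ge0 expr_ge1// ltW.
have q0 : 0 < q by rewrite sqrtr_gt0 subr_gt0 exprn_egt1.
have eph : expR ph = gamma + q by rewrite /ph /arcosh lnK// posrE addr_gt0.
have emph : expR (- ph) = gamma - q.
  rewrite expRN eph; apply: (mulfI (lt0r_neq0 (addr_gt0 gamma_gt0 q0))).
  by rewrite mulfV ?gt_eqF ?addr_gt0// [RHS]mulrC -subr_sqr q2 subKr.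
rewrite /cyclic_bound ltNge (ltW gamma1) /= gt_eqF// /cyclic_beta leNgt gamma1 /= -/ph.
rewrite [n%:R * ph / n%:R]mulrAC mulfV// mul1r; set b := n%:R * ph / 2.
apply: (fmorph_inj (real_complex R)) => /=.
(* The same roots, now real: a0 = gc cosh ph. *)
pose v := gc * expR ph; pose w := gc * expR (- ph).
have vw : (v%:C)%C + (w%:C)%C = 2 * (a0%:C)%C.
  rewrite -rmorphD -(rmorph_nat (real_complex R)) -rmorphM; congr (_%:C)%C.
  by rewrite /v /w eph emph [in RHS]a0E; move: (a0 / gc) => ga; ring.
have vw' : (v%:C)%C * (w%:C)%C = g ^+ 2.
  rewrite -rmorphM -rmorphXn; congr (_%:C)%C.
  by rewrite /v /w mulrACA expRxMexpNx_1 mulr1 expr2.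
have vBw : v - w = 2 * gc * q.
  by rewrite /v /w eph emph; move: (a0 / gc) => ga; ring.
have vneqw : (v%:C)%C != (w%:C)%C.
  by rewrite -subr_eq0 -rmorphB fmorph_eq0 vBw !mulf_neq0// gt_eqF.
rewrite (eigenvalue_sum c_gt0 hurwitzA vw vw' vneqw).
rewrite -rmorphB -!rmorphXn -rmorphB -rmorphD -(rmorph_nat (real_complex R)) -!fmorph_div -rmorphM.
congr (_%:C)%C.
have vn : v ^+ n = gc ^+ n * expR b ^+ 2.
  rewrite /v exprMn -!expRM_natl; congr (_ * expR _).
  by rewrite /b mulrCA mulfV ?mulr1// pnatr_eq0.
rewrite vn vBw /tanh /sinh /cosh eph emph expRN.
have g0 : 0 < gc ^+ n by rewrite exprn_gt0.
have := expR_gt0 b; set e := expR b => e0.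
have -> : gamma + q - (gamma - q) = 2 * q by move: (a0 / gc) => ga; ring.
move: g0; set G := gc ^+ n => G0; clear -G0 e0 q0 gc_gt0.
field.
by rewrite !gt_eqF// addr_gt0// mulr_gt0// exprn_gt0.
Qed.

Lemma cyclic_boundE :
  - \sum_(l <- eigenvalues A) (2 * complex.Re l)^-1 = cyclic_bound n gc gamma.
Proof.
have [g1|g1|g1] := ltgtP gamma 1; first exact: cyclic_bound_lt1; first exact: cyclic_bound_gt1.
rewrite /cyclic_bound g1 ltxx eqxx eigenvalue_sum_double//.
by rewrite a0E g1 mulr1.
Qed.

End cyclic_bound.

(** * The cyclic network *)

Section cyclic_network.
Variables (R : realType) (m : nat) (a c : 'I_m.+2 -> R).
Hypotheses (a_gt0 : forall i, 0 < a i) (c_gt0 : forall i, 0 < c i).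
Local Notation n := m.+2.
Local Notation r := (geometric_mean c / geometric_mean a).
Hypothesis gammaP : cos (pi / n%:R) < geometric_mean a / geometric_mean c.

Lemma gain_gt0 : 0 < r. Proof. by rewrite divr_gt0 ?geometric_mean_gt0. Qed.

Lemma gainX : r ^+ n * \prod_(i < n) a i = \prod_(i < n) c i.
Proof.
rewrite exprMn exprVn -(geometric_meanX (ltn0Sn _) a_gt0) divfK ?geometric_meanX//.
by rewrite -geometric_meanX// expf_neq0// gt_eqF// geometric_mean_gt0.
Qed.

Lemma secant_gap : 0 < 1 - r * cos (pi / n%:R).
Proof.
rewrite subr_gt0 -(@ltr_pM2l _ (r^-1)) ?invr_gt0 ?gain_gt0// mulKf ?gt_eqF ?gain_gt0//.
by rewrite mulr1 invf_div.
Qed.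

Lemma hurwitz_cyclic : hurwitz (cyclic_mx a c).
Proof.
apply: (@hurwitz_energy _ _ _ (cyclic_weight a c r)
  (fun i => a i * cyclic_weight a c r i) (1 - r * cos (pi / n%:R))).
- by move=> i; apply: cyclic_weight_gt0 => //; exact: gain_gt0.
- by move=> i; rewrite mulr_gt0//; apply: cyclic_weight_gt0 => //; exact: gain_gt0.
- exact: secant_gap.
- move=> v; have := cyclic_energy a_gt0 c_gt0 gain_gt0 gainX v.
  by under [X in _ <= _ * X -> _]eq_bigr do rewrite mulrA.
Qed.

End cyclic_network.

Lemma geometric_mean_cst (R : realType) n (x : R) : (0 < n)%N -> 0 < x ->
  geometric_mean (fun _ : 'I_n => x) = x.
Proof.
move=> n0 x0; apply: (@pexpIrn _ n) => //; rewrite ?nnegrE ?ltW ?geometric_mean_gt0//.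
by rewrite geometric_meanX// prodr_const card_ord.
Qed.

(** * Orthogonality of the signed cyclic shift *)

Section signed_shift.
Variables (R : realType) (m : nat).
Local Notation n := m.+2.
Local Notation C := (cyclic_mx (fun _ : 'I_n => 0 : R) (fun _ : 'I_n => 1)).

Lemma signed_shift_orthogonal : C *m C^T = 1%:M.
Proof.
apply/matrixP => i j; rewrite mxE [RHS]mxE.
transitivity (\sum_(k < n) idfun (C i k) * C j k).
  by apply: eq_bigr => k _; rewrite [in X in _ * X]mxE.
rewrite (cyclic_mx_row idfun) /= oppr0 mul0r add0r mul1r.
case: ifPn => [/eqP i0|i0].
  rewrite mxE mulN1r -!val_eqE /= i0.
  have [->|j0] /= := eqVneq (val j) 0%N; first by rewrite eqxx opprK.
  by case: ifP => _; [rewrite !oppr0|rewrite ltn_eqF ?oppr0].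
have i1 : (i.-1 < n)%N by rewrite (leq_ltn_trans (leq_pred _)).
rewrite mxE -!val_eqE /= inordK// prednK ?lt0n//.
have [ji|ji] := eqVneq (val j) (val i).
  rewrite ji; have -> : (val i == i.-1) = false; last by [].
  by apply/negbTE; rewrite -[X in X != _]prednK ?lt0n// neq_ltn ltnS leqnn orbT.
have -> : (i.-1 == m.+1)%N = false by rewrite ltn_eqF// -ltnS prednK ?lt0n.
by rewrite andbF oppr0 if_same.
Qed.

End signed_shift.

(** * Equal decay rates: inequality and equality case *)

Section equal_decay.
Variables (R : realType) (m : nat) (a0 : R) (c : 'I_m.+2 -> R).
Hypotheses (a0_gt0 : 0 < a0) (c_gt0 : forall i, 0 < c i).
Local Notation n := m.+2.
Local Notation gc := (geometric_mean c).
Local Notation A := (cyclic_mx (fun=> a0) c).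
Local Notation B := (cyclic_mx (fun=> a0) (fun _ : 'I_n => gc)).
Hypothesis gammaP : cos (pi / n%:R) < a0 / gc.

Let gc_gt0 : 0 < gc. Proof. exact: geometric_mean_gt0. Qed.

Let gcE : geometric_mean (fun _ : 'I_n => gc) = gc.
Proof. exact: geometric_mean_cst. Qed.

Let a0E : geometric_mean (fun _ : 'I_n => a0) = a0.
Proof. exact: geometric_mean_cst. Qed.

Let gammaA : cos (pi / n%:R) < geometric_mean (fun _ : 'I_n => a0) / gc.
Proof. by rewrite a0E. Qed.

Let gammaB : cos (pi / n%:R) <
  geometric_mean (fun _ : 'I_n => a0) / geometric_mean (fun _ : 'I_n => gc).
Proof. by rewrite a0E gcE. Qed.

Let kappa := a0 * (1 - gc / a0 * cos (pi / n%:R)).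

Let kappa_gt0 : 0 < kappa.
Proof. by rewrite mulr_gt0//; have := secant_gap (fun=> a0_gt0) c_gt0 gammaA; rewrite a0E. Qed.

(** For equal couplings all the energy weights reduce to [a0^-1], so the weighted estimate becomes
    dissipativity in the Euclidean norm. *)
Let dissB (v : 'rV[R]_n) : bilin B v v <= - kappa * bilin 1%:M v v.
Proof.
have := cyclic_energy (fun=> a0_gt0) (fun=> gc_gt0) (gain_gt0 (fun=> a0_gt0) (fun=> gc_gt0))
  (gainX (fun=> a0_gt0) (fun=> gc_gt0)) (v 0).
rewrite a0E gcE.
have wE i : cyclic_weight (fun=> a0) (fun=> gc) (gc / a0) i = a0^-1.
  rewrite /cyclic_weight big1 ?expr1n ?mul1r// => j _.
  by rewrite mulrCA mulfV ?mulr1 ?mulfV ?gt_eqF.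
under eq_bigr do rewrite wE -mulrA.
under [X in _ <= _ * X -> _]eq_bigr do rewrite wE mulrA mulfV ?gt_eqF// mul1r.
rewrite -mulr_sumr -(ler_pM2l a0_gt0) mulVKf ?gt_eqF// mulrA mulrN -/kappa.
congr (_ <= _ * _).
  rewrite bilinE; apply: eq_bigr => i _; rewrite mulr_sumr.
  by apply: eq_bigr => k _; rewrite mulrA.
by rewrite /bilin mulmx1 mxE; apply: eq_bigr => i _; rewrite mxE expr2.
Qed.

Let normalB : B *m B^T = B^T *m B.
Proof.
pose C : 'M[R]_n := cyclic_mx (fun=> 0) (fun=> 1).
have BE : B = gc *: C - a0%:M.
  apply/matrixP => i j; rewrite !mxE; case: eqP => _.
    by rewrite oppr0 mulr0 add0r mulr1n.
  case: ifP => _; last case: ifP => _;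
    by rewrite mulr0n subr0 ?mulr1 ?mulrN1 ?mulr0.
have CC : C *m C^T = 1%:M by exact: signed_shift_orthogonal.
have CC' : C^T *m C = 1%:M by exact: mulmx1C.
rewrite BE; clearbody C; rewrite linearB linearZ /= tr_scalar_mx !mulmxBl !mulmxBr.
rewrite -!scalemxAl -!scalemxAr CC CC' !mul_scalar_mx !mul_mx_scalar.
by apply/matrixP => i j; rewrite !mxE; ring.
Qed.

(* [A = D B D^-1] for the diagonal matrix [D] with entries [d k]. *)
Let d (k : nat) : R := \prod_(j < k) (c (inord j) / gc).

Let d_gt0 k : 0 < d k.
Proof. by apply: prodr_gt0 => j _; rewrite divr_gt0. Qed.

Let dS k : d k.+1 * gc = d k * c (inord k).
Proof. by rewrite /d big_ord_recr /= -[LHS]mulrA divfK// gt_eqF. Qed.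

(** After a full turn [d] returns to 1, because [gc] is the geometric mean; this is the corner entry
    of the similarity. *)
Let d_last : d m.+1 * c ord_max = gc.
Proof.
have <- : inord m.+1 = ord_max :> 'I_n by apply: val_inj; rewrite /= inordK.
rewrite -dS /d.
have -> : \prod_(j < n) (c (inord j) / gc) = 1; last by rewrite mul1r.
rewrite prodf_div prodr_const card_ord geometric_meanX//.
under eq_bigr do rewrite inord_val.
by rewrite mulfV// gt_eqF// prodr_gt0.
Qed.

Let similarAB (i k : 'I_n) : A i k * d k = d i * B i k.
Proof.
rewrite !mxE; case: eqP => [->|_]; first by rewrite mulrC.
case: eqP => [->|_].
  by rewrite dS mulrC; congr (_ * c _); apply: val_inj; rewrite /= inordK.
case: ifP => [/andP[/eqP -> /eqP km]|_]; last by rewrite mul0r mulr0.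
have kE : k = ord_max by apply: val_inj.
by rewrite km kE /= -d_last /d big_ord0 mul1r mulNr mulrC.
Qed.

(** Substituting X = D Y D and A = D B D^-1 in the Lyapunov equation of [A] turns its identity
    source into D^-2. *)
Let w : 'rV[R]_n := \row_i (d i ^+ 2)^-1.
Let Y := lyapunov_sol B (diag_mx w).
Let X : 'M[R]_n := \matrix_(i, j) (d i * Y i j * d j).

Let YE : B *m Y + Y *m B^T + diag_mx w = 0.
Proof. exact: lyapunov_solP kappa_gt0 dissB _. Qed.

Let lyapunovX : A *m X + X *m A^T + 1%:M = 0.
Proof.
have AX i j : (A *m X) i j = d i * (B *m Y) i j * d j.
  rewrite !mxE mulr_sumr mulr_suml; apply: eq_bigr => k _.
  rewrite [X k j]mxE -!mulrA [d i * _]mulrA -similarAB; ring.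
have XA i j : (X *m A^T) i j = d i * (Y *m B^T) i j * d j.
  rewrite !mxE mulr_sumr mulr_suml; apply: eq_bigr => k _.
  rewrite [X i k]mxE [A^T k j]mxE [B^T k j]mxE.
  transitivity (d i * Y i k * (A j k * d k)); first by ring.
  by rewrite similarAB; ring.
have addE (U V : 'M[R]_n) i j : (U + V) i j = U i j + V i j by rewrite mxE.
apply/matrixP => i j; move/matrixP/(_ i j) : YE; rewrite !addE => YEij.
rewrite AX XA [RHS]mxE.
have -> : (1%:M : 'M[R]_n) i j = d i * diag_mx w i j * d j.
  rewrite !mxE; case: eqP => [->|_]; last by rewrite !mulr0n mulr0 mul0r.
  rewrite !mulr1n; field; by rewrite gt_eqF.
by rewrite -!mulrDl -!mulrDr YEij mxE mulr0 mul0r.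
Qed.

Let traceX : \tr X =
  \sum_(i < n) \sum_(j < n) (d i / d j) ^+ 2 * diag_response B i j.
Proof.
apply: eq_bigr => i _; rewrite mxE /Y (lyapunov_sol_diag kappa_gt0 dissB) summxE.
rewrite mulr_sumr mulr_suml; apply: eq_bigr => j _.
have -> (k : R) (U : 'M[R]_n) : (k *: U) i i = k * U i i by rewrite mxE.
have -> : w 0 j = (d j ^+ 2)^-1 by rewrite mxE.
rewrite /diag_response.
by field; rewrite gt_eqF.
Qed.

Let S := - \sum_(l <- eigenvalues A) (2 * complex.Re l)^-1.

(** [A] is not normal in general; its spectral sum is transferred to [B] because both have the same
    closed form in [a0] and [gc]. *)
Let SE : S = \tr (invmx (- (B + B^T))).
Proof.
have hA := hurwitz_cyclic (fun=> a0_gt0) c_gt0 gammaA.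
have hB := hurwitz_cyclic (fun=> a0_gt0) (fun=> gc_gt0) gammaB.
rewrite (normal_trace_symmetric_part normalB hB).
have sA := cyclic_boundE a0_gt0 c_gt0 hA gammaP.
have sB := cyclic_boundE a0_gt0 (fun=> gc_gt0) hB.
by rewrite gcE in sB; exact: etrans sA (esym (sB gammaP)).
Qed.

Lemma cyclic_spectral_sum : S = cyclic_bound n gc (a0 / gc).
Proof.
have hA := hurwitz_cyclic (fun=> a0_gt0) c_gt0 gammaA.
exact: cyclic_boundE.
Qed.

Lemma cyclic_rho_ss : exists rho : R,
  [/\ is_rho_ss A 1%:M rho, S <= rho & rho = S <-> (forall i j, c i = c j)].
Proof.
exists (\tr X); split.
- apply: (@is_rho_ss_trace _ _ _ _
    (cyclic_weight (fun=> a0) c (gc / a0)) kappa) => //.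
  + by move=> i; apply: cyclic_weight_gt0 => //; rewrite divr_gt0.
  + move=> v; have := cyclic_energy (fun=> a0_gt0) c_gt0
      (gain_gt0 (fun=> a0_gt0) c_gt0) (gainX (fun=> a0_gt0) c_gt0) v.
    by rewrite a0E -mulr_sumr mulrA mulNr [_ * a0]mulrC.
- by rewrite SE traceX; exact: (trace_response_ge kappa_gt0 dissB normalB).
- split=> [rhoS|cE].
    (* The subdiagonal entry (k + 1, k) of [B] is nonzero, so the corresponding response is positive
       and equality in the trace inequality forces neighbouring scalings to agree. *)
    have step k : (k < m.+1)%N -> d k.+1 = d k.
      move=> km; have k1 : (k < n)%N by rewrite ltnS ltnW.
      pose i : 'I_n := inord k.+1; pose j : 'I_n := inord k.
      have iE : i = k.+1 :> nat by rewrite inordK.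
      have jE : j = k :> nat by rewrite inordK.
      rewrite -iE -jE; apply: (@trace_response_eq _ _ _ _ kappa_gt0 dissB normalB
        (fun i : 'I_n => d i)) => //; last by rewrite -traceX rhoS SE.
      apply: (diag_response_gt0 kappa_gt0 dissB).
      - by rewrite -val_eqE /= iE jE neq_ltn ltnSn orbT.
      - rewrite mxE -val_eqE /= iE jE eqxx gtn_eqF// ?gt_eqF//.
      - move=> l li lj; rewrite mxE eq_sym (negbTE li) iE eqSS.
        have -> : (k == l :> nat) = false; last by [].
        by apply/negbTE; rewrite -jE eq_sym val_eqE.
    have d1 k : (k <= m.+1)%N -> d k = 1.
      elim: k => [|k ih] km; first by rewrite /d big_ord0.
      by rewrite step// ih// ltnW.
    suff cg i : c i = gc by move=> i j; rewrite !cg.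
    have [im|] := ltnP i m.+1.
      have := dS i; rewrite (d1 _ im) (d1 _ (ltnW im)) !mul1r inord_val => gi.
      exact: esym gi.
    (* The last coupling sits on the closing edge and is recovered from [d_last] instead of [dS]. *)
    move=> mi; have -> : i = ord_max.
      by apply: val_inj; apply/eqP; rewrite eqn_leq mi -ltnS ltn_ord.
    have := d_last; rewrite (d1 _ (leqnn _)) mul1r => gi; exact: gi.
have cg i : c i = gc.
  apply: (@pexpIrn _ n) => //; rewrite ?nnegrE ?ltW//.
  rewrite geometric_meanX// -[in LHS](card_ord n) -prodr_const.
  by apply: eq_bigr => j _.
have d1 k : d k = 1.
  by apply: big1 => j _; rewrite cg mulfV// gt_eqF.
rewrite traceX SE; apply: eq_bigr => i _.
rewrite -(diag_response_row kappa_gt0 dissB normalB).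
by apply: eq_bigr => j _; rewrite !d1 divr1 expr1n mul1r.
Qed.

End equal_decay.

Theorem theorem2 (R : realType) (n : nat) (hn : (2 <= n)%N)
    (a c : 'I_n -> R)
    (ha : forall i : 'I_n, 0 < a i) (hc : forall i : 'I_n, 0 < c i)
    (hgamma : cos (pi / n%:R) < geometric_mean a / geometric_mean c) :
  hurwitz (cyclic_mx a c) /\
  ((forall i : 'I_n, a i = geometric_mean a) ->
   let S : R :=
     - \sum_(l <- eigenvalues (cyclic_mx a c)) (2 * complex.Re l)^-1 in
   S = cyclic_bound n (geometric_mean c) (geometric_mean a / geometric_mean c)
   /\
   exists rho : R,
     [/\ is_rho_ss (cyclic_mx a c) 1%:M rho,
         S <= rho
       & rho = S <-> (forall i j : 'I_n, c i = c j)]).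
Proof.
case: n hn a c ha hc hgamma => [|[|m]]// _ a c ha hc hgamma.
split; first exact: hurwitz_cyclic.
move=> aE.
have a0_gt0 : 0 < geometric_mean a by exact: geometric_mean_gt0.
have -> : cyclic_mx a c = cyclic_mx (fun=> geometric_mean a) c.
  by congr cyclic_mx; apply/funext => i; exact: aE.
split; first exact: cyclic_spectral_sum.
exact: cyclic_rho_ss.
Qed.
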